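(* Define \[ \Delta^*= \sum_{\ell} \frac{\ell^4}{(\ell+1)^2(\ell-1)}\prod_{p < \ell}\frac{p^2-p-1}{(p+1)^2(p-1)} \;(\approx 2.1514351057), \] where the sum is over all primes $\ell$ and the product over primes $p<\ell$. Then \[ \lim_{x\to\infty} \bigg( \sum_{q \leq x} \sum_{\substack{\chi\ (\mathrm{mod}\ q) \\ \chi\text{ primitive}}} 1 \bigg)^{-1} \bigg( \sum_{q \leq x} \sum_{\substack{\chi\ (\mathrm{mod}\ q) \\ \chi\text{ primitive}}} n_{\chi} \bigg) = \Delta^*, \] where $q$ runs over positive integers and $\chi$ over primitive nonprincipal Dirichlet characters modulo $q$.
   Context: For a nonprincipal Dirichlet character $\chi$, $n_\chi$ denotes the least positive integer $n$ with $\chi(n)\neq 0$ and $\chi(n)\neq 1$. A Dirichlet character modulo $q$ is primitive if it is not induced by a character of a proper divisor modulus; the trivial character modulo $1$ is excluded (only nonprincipal characters are considered). *)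

(* Defs.v *)
From HB Require Import structures.
From mathcomp Require Import all_boot all_order all_algebra.
From mathcomp Require Import all_classical all_reals all_analysis.
From mathcomp Require Import cyclic complex.
Set Implicit Arguments.
Unset Strict Implicit.
Unset Printing Implicit Defensive.
Import Order.TTheory GRing.Theory Num.Theory.
Import numFieldNormedType.Exports.
Local Open Scope classical_set_scope.
Local Open Scope ring_scope.
Local Open Scope complex_scope.

Definition dirichlet_character (R : realType) (q : nat) (chi : int -> R[i]) :=
  [/\ forall a, chi (a + q%:Z) = chi a,
      forall a b, chi (a * b) = chi a * chi b &
      forall a, (chi a != 0) = coprimez a q%:Z].

Definition nonprincipal (R : realType) (chi : int -> R[i]) :=
  exists a, chi a != 0 /\ chi a != 1.

Definition induced_by (R : realType) (q : nat) (chi psi : int -> R[i]) :=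
  forall a, chi a = if coprimez a q%:Z then psi a else 0.

Definition primitive (R : realType) (q : nat) (chi : int -> R[i]) :=
  dirichlet_character q chi /\
  ~ exists d (psi : int -> R[i]),
      [/\ (d %| q)%N, (d < q)%N, dirichlet_character d psi &
          induced_by q chi psi].

(* The character modulo 1 satisfies [primitive 1]; it is excluded here. *)
Definition primitive_characters (R : realType) (q : nat) :
  set (int -> R[i]) := [set chi | primitive q chi /\ nonprincipal chi].
Arguments primitive_characters R q : clear implicits.

(* Junk value 0 when no such n exists, which for a Dirichlet character means
   that it is principal. *)
Definition least_nonresidue (R : realType) (chi : int -> R[i]) : nat :=
  match pselect (exists n : nat,
    [&& (0 < n)%N, chi n%:Z != 0 & chi n%:Z != 1]) with
  | left exn => ex_minn exn
  | right _ => 0%N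
  end.

Definition Delta_star_term (R : realType) (l : nat) : R :=
  l%:R ^+ 4 / ((l%:R + 1) ^+ 2 * (l%:R - 1)) *
  \prod_(0 <= p < l | prime p)
    ((p%:R ^+ 2 - p%:R - 1) / ((p%:R + 1) ^+ 2 * (p%:R - 1))).

Definition Delta_star (R : realType) : R :=
  limn (fun n => \sum_(0 <= l < n | prime l) Delta_star_term R l).

(* A sum over an infinite set is 0 by convention; the following ensures that
   the sums over [primitive_characters] are genuine. *)
Lemma finite_primitive_characters (R : realType) (q : nat) :
  (0 < q)%N -> finite_set (primitive_characters R q).
Proof.
move=> q0.
pose P : {poly R[i]} := 'X^(totient q) - 1.
have [rs Prs] := closed_field_poly_normal P.
have P0 : P != 0.
  by rewrite -size_poly_gt0 size_XnsubC // totient_gt0.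
pose s := 0 :: rs.
pose G (f : {ffun 'I_q -> seq_sub s}) : int -> R[i] :=
  fun a => if insub (absz (a %% q%:Z)%Z) is Some i then ssval (f i) else 0.
apply: (@sub_finite_set _ _ (G @` setT)); last first.
  by apply: finite_image; exact: finite_finset.
move=> chi [[[per mul cop] _] _].
have perk a (k : nat) : chi (a + k%:Z * q%:Z) = chi a.
  elim: k => [|k IH]; first by rewrite mul0r addr0.
  by rewrite intS mulrDl mul1r addrCA addrC per.
have perz a : chi (a %% q%:Z)%Z = chi a.
  rewrite [in RHS](divz_eq a q%:Z).
  case: (a %/ q%:Z)%Z => k; first by rewrite addrC perk.
  by rewrite -[RHS](perk _ k.+1) NegzE mulNr addrAC addNr add0r.
have chi1 : chi 1 = 1.
  have n0 : chi 1 != 0 by rewrite cop /coprimez /gcdz /= gcd1n.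
  by apply: (mulfI n0); rewrite -mul mulr1 mulr1.
have chiX a n : chi (a ^+ n) = chi a ^+ n.
  by elim: n => [|n IH]; rewrite ?expr0 // !exprS mul IH.
have ins a : chi a \in s.
  rewrite inE; case: eqP => //= /eqP n0.
  have : root P (chi a).
    rewrite /root !hornerE -chiX -perz -modzXm.
    have q0z : q%:Z != 0 by rewrite eqz_nat -lt0n.
    have: (0 <= (a %% q%:Z)%Z) by exact: modz_ge0.
    have: coprimez (a %% q%:Z)%Z q%:Z by rewrite -cop perz.
    case: (a %% q%:Z)%Z => // m cm _.
    rewrite -rmorphXn /= modz_nat.
    rewrite Euler_exp_totient //.
    by rewrite -modz_nat perz chi1 subrr.
  by rewrite Prs rootZ ?lead_coef_eq0 // root_prod_XsubC.
exists [ffun i : 'I_q => SeqSub (ins (val i)%:Z)] => //.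
apply/funext => a; rewrite /G.
have q0z : q%:Z != 0 by rewrite eqz_nat -lt0n.
have := modz_ge0 a q0z; have := ltz_pmod a (_ : 0 < q%:Z).
rewrite -[in RHS]perz.
case: (a %% q%:Z)%Z => // m /(_ q0) lmq _.
by rewrite /= insubT ffunE.
Qed.

(* Main.v *)
Require Import Defs.
From HB Require Import structures.
From mathcomp Require Import all_boot all_order all_algebra.
From mathcomp Require Import all_classical all_reals all_analysis.
From mathcomp Require Import complex.
From mathcomp Require Import fingroup zmodp finalg pgroup center cyclic action
  finmap.
From mathcomp Require Import separable cyclotomic mxrepresentation.
From mathcomp Require Import ring lra zify.
Set Implicit Arguments.
Unset Strict Implicit.
Unset Printing Implicit Defensive.
Import Order.TTheory GRing.Theory Num.Theory.
Import numFieldNormedType.Exports.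
Local Open Scope classical_set_scope.
Local Open Scope ring_scope.

(** Write [n_chi] as the sum over [z >= 0] of the indicator of [z < n_chi], and
    let [F z x] be the number of primitive nonprincipal characters of conductor
    at most [x] with [n_chi > z], that is, with values in {0, 1} at all primes
    [p <= z].

    For fixed [z], the characters with [chi p = 1] for some [p <= z] are
    negligible, since [p] has order at least [log q / log p] modulo [q]; so
    [F z x] is asymptotically the number of primitive characters whose conductor is
    divisible by all [p <= z].  The numbers [phi* q] of primitive characters
    satisfy [phi = 1 * phi*] and [id = 1 * phi] (Dirichlet convolutions), also
    after restriction to the integers coprime to given primes.  Such a
    convolution is inverted asymptotically without any Moebius function, because
    the sum of [1 / d ^ 2] over [d >= 2] is less than 1.  This gives
    [F z x ~ c x ^ 2 D z], where [D z] is the product of the local densities.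

    The tail is controlled uniformly.  For [z <= (log x) ^ A], all but a
    proportion [O (1 / z ^ 2)] of the moduli [q] are coprime to many primes
    [p <= z], whose products give many residues on which [chi] is 1;
    orthogonality then bounds the number of [chi].  For larger [z], a large sieve
    over all primitive characters, with the trivial bound [q q'] for the sums of
    [chi * conj chi'], leaves at most [x ^ (1/2 + o(1))] characters, and each has
    [n_chi <= x].  Hence the average tends to the sum of the [D z], which equals
    [Delta_star] by summation by parts. *)

(** * Characters of finite abelian groups *)

(** In characteristic 0 the polynomial [X ^ n - 1] is separable, so it has [n] distinct roots, one
    of which is primitive. *)
Lemma closed_prim_root_exists (C : numClosedFieldType) (n : nat) :
  (0 < n)%N -> exists z : C, n.-primitive_root z.
Proof.
move=> n0; pose p : {poly C} := 'X^n - 1.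
have [r Dp] := closed_field_poly_normal p.
have sz_p : size p = n.+1 by rewrite size_XnsubC.
move: Dp; rewrite (monicP _) ?monicXnsubC // scale1r => Dp.
have rn1 : all n.-unity_root r.
  by apply/allP => z; rewrite -root_prod_XsubC -Dp.
have sz_r : (n <= size r)%N.
  by rewrite -ltnS -[(size r).+1](size_prod_XsubC _ id) -Dp sz_p.
have [|z] := hasP (has_prim_root n0 rn1 _ sz_r); last by exists z.
by rewrite -separable_prod_XsubC -Dp separable_Xn_sub_1 // pnatr_eq0 -lt0n.
Qed.

(** Over a field with enough roots of unity the irreducible representations of an abelian group have
    degree 1, and there are as many as conjugacy classes, that is [#|G|]. The characters are the
    scalars [irr_mode] by which the elements act. *)
Lemma abelian_characters (C : numClosedFieldType) (gT : finGroupType)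
    (G : {group gT}) : abelian G ->
  exists f : 'I_#|G| -> gT -> C,
   [/\ forall i, f i 1%g = 1,
       forall i, {in G &, forall x y, f i (x * y)%g = f i x * f i y} &
       forall i j, {in G, f i =1 f j} -> i = j].
Proof.
move=> cGG.
have [z zP] := closed_prim_root_exists C (cardG_gt0 G).
have splitG := primitive_root_splitting_abelian zP cGG.
have F'G : ([pchar C]^'.-group G)%g by apply: sub_in_pnat (pnat_pi (cardG_gt0 G))
  => p _ _; rewrite inE /= pchar_num.
pose sG : irrType C G := DecSocleType (regular_repr C G).
have card_sG : #|sG| = #|G|.
  by rewrite card_irr_pchar //; apply/eqP; rewrite -card_classes_abelian.
have linX := irr_degree_abelian splitG cGG (_ : sG).
have sub x : x \in G -> x \in 'Z(G)%g by rewrite (center_idP cGG).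
exists (fun i => irr_mode (enum_val (cast_ord (esym card_sG) i) : sG)).
split => [i|i x y Gx Gy|i j eqij].
- exact: irr_mode1.
- by rewrite irr_modeM // sub.
apply: (can_inj (cast_ordKV card_sG)); apply: enum_val_inj.
move: eqij; move: (enum_val _) (enum_val _) => V W eqVW.
(* Equal modes give similar representations, with the identity matrix as intertwiner, and similar
   irreducible representations have the same index. *)
rewrite -(irr_reprK_pchar F'G V) -(irr_reprK_pchar F'G W).
have scalX U x : x \in G -> irr_repr (U : sG) x = (irr_mode U x)%:M.
  by move=> Gx; apply: irr_center_scalar; rewrite ?sub.
have : {in G, forall x, irr_repr V x = (irr_mode W x)%:M}.
  by move=> x Gx; rewrite scalX // (eqVW x Gx).
move: (irr_repr V) (irr_repr W) (scalX W); clear scalX.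
rewrite !linX => rV rW Wx Vx; apply: irr_comp_rsim_pchar => //.
exists 1%:M; rewrite ?row_free_unit ?unitmx1 // => x Gx.
by rewrite mulmx1 mul1mx Wx // Vx.
Qed.

(** * Almost orthogonal families *)

(** Cauchy-Schwarz against the constant function 1, from the nonnegativity of the sum of
    [(u * |g i| - t) ^ 2]. *)
Lemma sqr_sum_norm_le (C : numClosedFieldType) (I : finType) (U : {set I})
    (g : I -> C) :
  `|\sum_(i in U) g i| ^+ 2 <= #|U|%:R * \sum_(i in U) `|g i| ^+ 2.
Proof.
set t : C := \sum_(i in U) `|g i|; set u : C := #|U|%:R.
set v : C := \sum_(i in U) `|g i| ^+ 2.
have t0 : 0 <= t by apply: sumr_ge0.
apply: (@le_trans _ _ (t ^+ 2)).
  by rewrite lerXn2r // ?nnegrE // ler_norm_sum.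
have [U0|U0] := eqVneq #|U| 0%N.
  by rewrite /t /u U0 mul0r big1 ?expr0n //= => i; rewrite (cards0_eq U0) inE.
have u0 : 0 < u by rewrite ltr0n lt0n.
have : 0 <= \sum_(i in U) (u * `|g i| - t) ^+ 2.
  by apply: sumr_ge0 => i _;
    rewrite real_exprn_even_ge0 // rpredB ?ger0_real // mulr_ge0 // ltW.
have -> : \sum_(i in U) (u * `|g i| - t) ^+ 2 = u * (u * v - t ^+ 2).
  rewrite (eq_bigr (fun i => u ^+ 2 * `|g i| ^+ 2 - (2 * u * t) * `|g i| + t ^+ 2)).
    rewrite big_split /= sumrB -!mulr_sumr -/t -/v sumr_const -mulr_natl -/u; ring.
  by move=> i _; ring.
by rewrite pmulr_rge0 // subr_ge0.
Qed.

(** Let [S] be the sum of the functions [f i]. Its squared norm over [n < N] expands into inner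
    products, bounded by [D] on the diagonal and by [K] off it, while Cauchy-Schwarz on [U] bounds
    it below by [(size s * M) ^ 2 / #|U|]. With [K = 0] this is orthogonality, with [K > 0] a large
    sieve. *)
Lemma quasi_bessel (C : numClosedFieldType) (T : eqType) (s : seq T)
    (f : T -> nat -> C) (N : nat) (U : {set 'I_N}) (D K M : nat) :
  uniq s ->
  {in s, forall i, \sum_(n < N) f i n * (f i n)^* <= D%:R} ->
  {in s &, forall i j, i != j -> `|\sum_(n < N) f i n * (f j n)^*| <= K%:R} ->
  {in s, forall i, M%:R <= \sum_(n in U) f i n} ->
  ((size s * M) ^ 2 <= #|U| * (size s * D + size s ^ 2 * K))%N.
Proof.
move=> us hD hK hM.
pose S n := \sum_(i <- s) f i n.
pose A := \sum_(n < N) `|S n| ^+ 2.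
have A0 : 0 <= A by apply: sumr_ge0 => n _; rewrite exprn_ge0.
have AE : A = \sum_(i <- s) \sum_(j <- s) \sum_(n < N) f i n * (f j n)^*.
  rewrite /A (eq_bigr (fun n : 'I_N =>
    \sum_(i <- s) \sum_(j <- s) f i n * (f j n)^*)).
    by rewrite exchange_big /=; apply: eq_bigr => i _; rewrite exchange_big.
  by move=> n _; rewrite normCK /S rmorph_sum mulr_suml; apply: eq_bigr => i _;
    rewrite mulr_sumr.
have AB : A <= (size s * D + size s ^ 2 * K)%:R.
  rewrite -(ger0_norm A0) AE.
  apply: (@le_trans _ _ (\sum_(i <- s) (D + size s * K)%:R)); last first.
    rewrite big_const_seq count_predT iter_addr_0 -mulrnA ler_nat.
    by rewrite -mulnn; nia.
  apply: (le_trans (ler_norm_sum _ _ _)); rewrite big_seq [leRHS]big_seq.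
  apply: ler_sum => i si; apply: (le_trans (ler_norm_sum _ _ _)).
  rewrite (bigD1_seq i) //= natrD lerD //.
    rewrite ger0_norm ?hD // sumr_ge0 // => n _; exact: mul_conjC_ge0.
  apply: (@le_trans _ _ (\sum_(j <- s | j != i) K%:R)).
    rewrite big_seq_cond [leRHS]big_seq_cond; apply: ler_sum => j /andP[sj ji].
    by apply: hK => //; rewrite eq_sym.
  rewrite big_const_seq iter_addr_0 -mulrnA ler_nat mulnC.
  by rewrite leq_mul2r count_size orbT.
have B : (size s * M)%:R <= \sum_(n in U) S n.
  have -> : (size s * M)%:R = \sum_(i <- s) M%:R :> C.
    by rewrite big_const_seq count_predT iter_addr_0 -mulrnA mulnC.
  rewrite /S exchange_big /= big_seq [leRHS]big_seq.
  exact: ler_sum.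
rewrite -(@ler_nat C) natrM natrX.
apply: (@le_trans _ _ (#|U|%:R * \sum_(n in U) `|S n| ^+ 2)).
  apply: le_trans (sqr_sum_norm_le _ _).
  rewrite lerXn2r // ?nnegrE //; apply: (le_trans B).
  by rewrite ger0_norm // (le_trans _ B).
rewrite ler_wpM2l //; apply: le_trans AB.
rewrite /A [leRHS](bigID [in U]) /= lerDl; apply: sumr_ge0 => n _;
  rewrite exprn_ge0 //.
Qed.

Local Open Scope nat_scope.

(** * Prime numbers *)

Definition primes_upto (z : nat) : seq nat := [seq p <- iota 0 z.+1 | prime p].

Lemma mem_primes_upto (z p : nat) : (p \in primes_upto z) = prime p && (p <= z).
Proof. by rewrite mem_filter mem_iota ltnS. Qed.

Lemma primes_upto_uniq (z : nat) : uniq (primes_upto z).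
Proof. by rewrite filter_uniq // iota_uniq. Qed.

(** By Legendre's formula the exponent is the sum over [k] of [2m %/ p ^ k - 2 (m %/ p ^ k)]; each
    term is at most 1 and vanishes once [p ^ k > 2m]. *)
Lemma pfactor_central_binomial_le (p m : nat) : prime p -> 0 < m ->
  p ^ logn p 'C(m.*2, m) <= m.*2.
Proof.
move=> pp m0; have p1 := prime_gt1 pp.
have C0 : 0 < 'C(m.*2, m) by rewrite bin_gt0 -addnn leq_addr.
suff H : logn p 'C(m.*2, m) <= trunc_log p m.*2.
  apply: leq_trans (trunc_logP p1 _); last by rewrite double_gt0.
  by rewrite leq_exp2l.
have m2m : m <= m.*2 by rewrite -addnn leq_addr.
have := congr1 (logn p) (bin_fact m2m).
rewrite (_ : m.*2 - m = m); last by rewrite -addnn addnK.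
rewrite !lognM ?muln_gt0 ?fact_gt0 // !logn_fact //.
have -> : \sum_(1 <= k < m.+1) m %/ p ^ k = \sum_(1 <= k < m.*2.+1) m %/ p ^ k.
  rewrite [RHS](@big_cat_nat _ _ _ m.+1) //=.
  rewrite [X in _ = _ + X]big_nat_cond [X in _ = _ + X]big1 ?addn0 // =>
    k /andP[/andP[mk _] _].
  by rewrite divn_small // (ltn_trans mk) // ltn_expl.
set T := trunc_log p m.*2.
have : \sum_(1 <= k < m.*2.+1) m.*2 %/ p ^ k <=
    T + (\sum_(1 <= k < m.*2.+1) m %/ p ^ k).*2.
  have TE : \sum_(1 <= k < m.*2.+1) (k <= T) <= T.
    have [Tm|Tm] := leqP T m.*2; last first.
      apply: (@leq_trans (\sum_(1 <= k < m.*2.+1) 1)).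
        by apply: leq_sum => k _; exact: leq_b1.
      by rewrite sum_nat_const_nat muln1 subn1 ltnW.
    rewrite (@big_cat_nat _ _ _ T.+1) //= [X in _ + X]big_nat_cond [X in _ + X]big1
      ?addn0.
      apply: (@leq_trans (\sum_(1 <= k < T.+1) 1)).
        by apply: leq_sum => k _; exact: leq_b1.
      by rewrite sum_nat_const_nat muln1 subn1.
    by move=> k /andP[/andP[Tk _] _]; rewrite leqNgt Tk.
  apply: leq_trans (leq_add TE (leqnn _)).
  rewrite -[(\sum_(1 <= k < m.*2.+1) m %/ p ^ k).*2]muln2 big_distrl /= -big_split
    /= big_nat_cond [leqRHS]big_nat_cond.
  apply: leq_sum => k /andP[/andP[k1 _] _].
  have pk0 : 0 < p ^ k by rewrite expn_gt0 prime_gt0.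
  have [kT|Tk] := leqP k T.
    rewrite -addnn divnD //; lia.
  rewrite divn_small //; apply: (leq_trans (trunc_log_ltn _ p1)).
  by rewrite leq_exp2l.
by rewrite -addnn; lia.
Qed.

Lemma central_binomial_ge (m : nat) : 2 ^ m <= 'C(m.*2, m).
Proof.
elim: m => [|m IH] //.
rewrite doubleS binS expnS mul2n -addnn leq_add // (leq_trans IH) //.
  by rewrite binS leq_addl.
by rewrite leq_bin2l.
Qed.

(** The central binomial coefficient is at least [2 ^ m], and it is a product of prime powers at
    most [2m], one for each of its prime divisors. *)
Lemma chebyshev_lower (m : nat) : 0 < m ->
  2 ^ m <= m.*2 ^ size (primes_upto m.*2).
Proof.
move=> m0; apply: (leq_trans (central_binomial_ge m)).
have C0 : 0 < 'C(m.*2, m) by rewrite bin_gt0 -addnn leq_addr.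
rewrite [leqLHS]prod_prime_decomp // prime_decompE big_map /=.
have lep p : p \in primes 'C(m.*2, m) -> p ^ logn p 'C(m.*2, m) <= m.*2.
  by rewrite mem_primes => /and3P[pp _ _]; exact: pfactor_central_binomial_le.
apply: (@leq_trans (\prod_(p <- primes 'C(m.*2, m)) m.*2)).
  by rewrite big_seq [leqRHS]big_seq; apply: leq_prod.
rewrite big_const_seq count_predT iter_muln_1 leq_pexp2l ?double_gt0 //.
apply: uniq_leq_size => [|p pC]; first exact: primes_uniq.
rewrite mem_primes_upto; apply/andP; split.
  by move: pC; rewrite mem_primes => /and3P[].
apply: leq_trans (lep _ pC); rewrite -{1}[p]expn1 leq_pexp2l //.
  by move: pC; rewrite mem_primes => /and3P[/prime_gt0].
by rewrite logn_gt0.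
Qed.

(** With [v = trunc_log 2 x] one has [(v + 1) ^ 2 <= 4 * 2 ^ v <= 4 x], and [4 c ^ 2 <= x] absorbs
    the factor [c]. *)
Lemma trunc_log_small (c x : nat) : 4 * c ^ 2 <= x ->
  c * (trunc_log 2 x).+1 <= x.
Proof.
have [->|c0] := posnP c; first by [].
move=> cx; have x0 : 0 < x by apply: leq_trans cx; rewrite muln_gt0 expn_gt0 c0.
set v := trunc_log 2 x; have vx : 2 ^ v <= x by apply: trunc_logP.
move: (v) vx => {}v vx.
have h : (v.+1) ^ 2 <= 4 * 2 ^ v.
  have h1 := ltn_expl v./2 (isT : 1 < 2).
  have h2 : 2 ^ v./2 * 2 ^ v./2 <= 2 ^ v.
    by rewrite -expnD leq_exp2l // addnn -{2}[v]odd_double_half leq_addl.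
  have h3 : v <= v./2.*2.+1 by rewrite -{1}[v]odd_double_half; case: odd.
  move: (v./2) (2 ^ v./2) h1 h2 h3 => u y h1 h2 h3.
  have h4 : v.+1 <= 2 * y by lia.
  rewrite -mulnn (leq_trans (leq_mul h4 h4)) // mulnACA leq_mul2l h2.
  by rewrite orbT.
rewrite -(@leq_exp2r _ _ 2) // expnMn.
apply: (@leq_trans (c ^ 2 * (4 * x))).
  by rewrite leq_mul2l (leq_trans h) ?orbT // leq_mul2l vx.
by rewrite mulnCA mulnA -mulnn leq_mul2r cx orbT.
Qed.

(** Chebyshev's bound after taking logarithms; [a] is an upper bound for [log2 z]. *)
Lemma primes_upto_lower (z a : nat) : z <= 2 ^ a ->
  z./2 <= a * size (primes_upto z).
Proof.
move=> za; have [->//|m0] := posnP z./2.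
have mz : z./2.*2 <= z by rewrite -{2}[z]odd_double_half leq_addl.
rewrite -(@leq_exp2l 2) // expnM; apply: (leq_trans (chebyshev_lower m0)).
apply: (@leq_trans ((2 ^ a) ^ size (primes_upto z./2.*2))).
  have [->|s0] := posnP (size (primes_upto z./2.*2)); first by rewrite !expn0.
  by rewrite leq_exp2r // (leq_trans mz).
rewrite leq_pexp2l ?expn_gt0 //; apply: uniq_leq_size;
  first exact: primes_upto_uniq.
by move=> p; rewrite !mem_primes_upto => /andP[-> pz]; rewrite (leq_trans pz).
Qed.

Lemma size_primes_upto (r : nat) : size (primes_upto r) <= r.
Proof.
have -> : r = size (iota 1 r) by rewrite size_iota.
apply: uniq_leq_size; first exact: primes_upto_uniq.
move=> p; rewrite mem_primes_upto mem_iota size_iota => /andP[/prime_gt0 -> pr].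
by rewrite add1n ltnS.
Qed.

Lemma exists_sqrt (z : nat) : exists2 r, r * r <= z & z < r.+1 * r.+1.
Proof.
elim: z => [|z [r h1 h2]]; first by exists 0.
have [h|h] := leqP (r.+1 * r.+1) z.+1; last by exists r => //; apply: leqW.
by exists r.+1 => //; nia.
Qed.

(** By Chebyshev's bound the primes up to [z] far outnumber the integers up to [r], the integer
    square root of [z]. The condition [z < p * p] makes any four of the primes multiply to more than
    [z ^ 2]. *)
Lemma many_large_primes (m : nat) : exists z0, forall z, z0 <= z ->
  exists S, [/\ size S =
    m, uniq S & {in S, forall p, [/\ prime p, p <= z & z < p * p]}].
Proof.
(* The 2000 puts [r] well above [4 * 16 ^ 2 = 1024], the threshold of [trunc_log_small] for
   [c = 16]. *)
exists ((m + 2000).+1 * (m + 2000).+1) => z zm; have [r r1 r2] := exists_sqrt z.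
have rm : m + 2000 <= r.
  have : (m + 2000).+1 < r.+1.
    by rewrite -ltn_sqr -!mulnn; exact: leq_ltn_trans zm r2.
  by rewrite ltnS => /ltnW.
set v := trunc_log 2 r.+1.
have v1 : r.+1 < 2 ^ v.+1 by exact: trunc_log_ltn.
have v2 : 16 * v.+1 <= r.+1 by apply: trunc_log_small; move: rm;
  rewrite (_ : 4 * 16 ^ 2 = 1024) //; lia.
have za : z <= 2 ^ (2 * v.+1).
  by rewrite mulnC expnM -mulnn (leq_trans (ltnW r2)) // leq_mul // ltnW.
have := primes_upto_lower za; set P := primes_upto z => hP.
pose S := [seq p <- P | z < p * p].
have Ssz : m <= size S.
  have E : size P = size S + size [seq p <- P | ~~ (z < p * p)].
    by rewrite -(count_predC (fun p => z < p * p) P) !size_filter.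
  have : size [seq p <- P | ~~ (z < p * p)] <= r.
    apply: leq_trans (size_primes_upto r); apply: uniq_leq_size.
      exact/filter_uniq/primes_upto_uniq.
    move=> p; rewrite mem_filter !mem_primes_upto -leqNgt => /and3P[pz -> _] /=.
    by rewrite -ltnS -ltn_sqr -!mulnn; exact: leq_ltn_trans r2.
  have : z <= z./2.*2.+1 by rewrite -{1}[z]odd_double_half; case: odd.
  move: (size P) (size S) (size _) E hP => a b c E hP; nia.
exists (take m S); split.
- by rewrite size_takel.
- exact/take_uniq/filter_uniq/primes_upto_uniq.
- by move=> p /mem_take; rewrite mem_filter mem_primes_upto => /and3P[].
Qed.

(** Induction on [j] through [j.+1 * 'C(k.+1, j.+1) = k.+1 * 'C(k, j)]. *)
Lemma leq_bin_exp (k j t : nat) : j * t <= k -> t ^ j <= 'C(k, j).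
Proof.
elim: j k => [|j IH] [|k] h; rewrite ?expn0 ?bin0 //.
  by move: h; rewrite leqn0 muln_eq0 /= => /eqP ->; rewrite exp0n.
have [->|t0] := posnP t; first by rewrite exp0n.
rewrite -(@leq_pmul2l j.+1) // -mul_bin_diag expnS mulnA leq_mul // IH //.
by move: h; rewrite mulSn; lia.
Qed.

Lemma exp_size_primes_le (q : nat) : 0 < q -> 2 ^ size (primes q) <= q.
Proof.
move=> q0; rewrite [leqRHS]prod_prime_decomp // prime_decompE big_map /=.
rewrite -[size _]count_predT -iter_muln_1 -big_const_seq.
rewrite big_seq [leqRHS]big_seq; apply: leq_prod => p pq.
have p1 : 1 < p by move: pq; rewrite mem_primes => /and3P[/prime_gt1].
apply: (leq_trans p1); rewrite -{1}[p]expn1 leq_pexp2l ?logn_gt0 //; exact: ltnW.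
Qed.

Lemma leq_exp2r_mono (m n e : nat) : m <= n -> m ^ e <= n ^ e.
Proof. by case: e => // e mn; rewrite leq_exp2r. Qed.

(** At most [log2 q] primes divide [q]; this is at most of order [t * log t], hence below [t ^ 19],
    whereas Chebyshev's bound gives more than [401 * t ^ 19] primes up to [t ^ 20]. *)
Lemma many_coprime_primes : exists t0, forall t, t0 <= t ->
  forall n q, n < t.+1 ^ (840 * t.+1) -> 0 < q <= n ->
  exists s, [/\ size s = 400 * t ^ 19, uniq s, all prime s &
    {in s, forall p, (p <= t ^ 20) && ~~ (p %| q)}].
Proof.
(* The threshold ensures [c * (log2 t + 1) <= t], where [c] exceeds both the loss [40 * 401] in
   Chebyshev's bound at [t ^ 20] and the loss from the factor 840 in the bound for [log2 q]. *)
exists (4 * (40 * 402 * 2) ^ 2).+1 => t;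
  set c := 40 * 402 * 2 => tc n q nt /andP[q0 qn].
have t1 : 1 < t by apply: leq_trans tc.
have t0 : 0 < t by apply: ltnW.
set w := trunc_log 2 t; have w1 : t < 2 ^ w.+1 by exact: trunc_log_ltn.
have w2 : c * w.+1 <= t by apply: trunc_log_small; apply: ltnW.
move: (w) w1 w2 => {tc}{}w w1 w2.
have zb : t ^ 20 <= 2 ^ (w.+1 * 20) by rewrite [leqRHS]expnM;
  apply: leq_exp2r_mono; exact: ltnW.
have := primes_upto_lower zb; set P := primes_upto (t ^ 20) => hP.
pose S := [seq p <- P | ~~ (p %| q)].
have dS : size [seq p <- P | p %| q] <= size (primes q).
  apply: uniq_leq_size; first exact/filter_uniq/primes_upto_uniq.
  move=> p; rewrite mem_filter mem_primes_upto => /and3P[pq pp _].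
  by rewrite mem_primes pp q0.
have pq : size (primes q) <= t ^ 19.
  have h1 : 2 ^ size (primes q) < 2 ^ (w.+2 * (840 * t.+1)).
    apply: leq_ltn_trans (exp_size_primes_le q0) _; apply: leq_ltn_trans qn _.
    apply: (leq_trans nt); rewrite [leqRHS]expnM; apply: leq_exp2r_mono.
    apply: (leq_trans w1); rewrite leq_exp2l //.
  move: h1; rewrite ltn_exp2l // => h1.
  apply: (leq_trans (ltnW h1)); apply: (@leq_trans (t ^ 2)); last first.
    by rewrite leq_pexp2l.
  rewrite -mulnn; move: w2; rewrite /c; nia.
have Ssz : 400 * t ^ 19 <= size S.
  have E : size P = size [seq p <- P | p %| q] + size S.
    by rewrite -(count_predC (fun p => p %| q) P) !size_filter.
  have h2 : (t ^ 20) <= ((t ^ 20)./2).*2.+1 by rewrite -{1}[t ^ 20]odd_double_half;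
    case: odd.
  have T0 : 0 < t ^ 19 by rewrite expn_gt0 t0.
  move: hP h2; rewrite [t ^ 20]expnS.
  move: (t ^ 19) pq T0 => T pq T0; move: ((t * T)./2) => m hP h2.
  move: (size P) (size S) (size (primes q)) (size [seq p <- P | p %| q]) E hP pq dS
    => a b d f E hP pq dS.
  rewrite leqNgt; apply/negP => bT.
  have aT : a <= 401 * T by lia.
  have : m <= w.+1 * 20 * (401 * T) by apply: (leq_trans hP);
    rewrite leq_mul2l aT orbT.
  have : c * w.+1 * T <= t * T by rewrite leq_mul2r w2 orbT.
  rewrite /c; nia.
exists (take (400 * t ^ 19) S); split.
- by rewrite size_takel.
- exact/take_uniq/filter_uniq/primes_upto_uniq.
- by apply/allP => p /mem_take; rewrite mem_filter mem_primes_upto => /and3P[].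
- by move=> p /mem_take; rewrite mem_filter mem_primes_upto => /and3P[-> _ ->].
Qed.

(* A slowly growing cutoff: [log n] has order [t * log t] for [t = cutoff n],
   so that powers of [t] play the role of powers of [log n]. *)
Definition cutoff (n : nat) : nat := \max_(t < n.+1 | t ^ (840 * t) <= n) t.

Lemma cutoff_ge (n t : nat) : t ^ (840 * t) <= n -> t <= cutoff n.
Proof.
move=> h; have tn : t < n.+1.
  rewrite ltnS; apply: leq_trans h; case: t => // t.
  by rewrite -{1}[t.+1]expn1 leq_pexp2l // muln_gt0.
exact: (@leq_bigmax_cond _ (fun i : 'I_n.+1 => i ^ (840 * i) <= n) _ (Ordinal tn)).
Qed.

Lemma cutoff_le (n : nat) : 0 < n -> cutoff n ^ (840 * cutoff n) <= n.
Proof.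
move=> n0; rewrite /cutoff; have [|t ht ->] :=
  @eq_bigmax_cond _ [pred i : 'I_n.+1 | i ^ (840 * i) <= n] (fun i => i : nat).
  by apply/card_gt0P; exists ord0; rewrite inE /= expn0.
exact: ht.
Qed.

Lemma cutoff_lt (n : nat) : n < (cutoff n).+1 ^ (840 * (cutoff n).+1).
Proof. by rewrite ltnNge; apply/negP => /cutoff_ge; rewrite ltnn. Qed.

Local Open Scope ring_scope.

(** * Inverting Dirichlet convolutions *)

Lemma cvgn_leP (R : realType) (u : nat -> R) (l : R) :
  (u n @[n --> \oo] --> l) <->
  (forall e, 0 < e -> exists N, forall n, (N <= n)%N -> `|u n - l| <= e).
Proof.
split=> [/cvgrPdist_le cu e e0|H].
  have [N _ HN] := cu _ e0; exists N => n Nn; rewrite distrC.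
  exact: HN.
apply/cvgrPdist_le => e e0; have [N HN] := H _ e0.
by exists N => // n /= Nn; rewrite distrC; apply: HN.
Qed.

Lemma sum_inv_sqr_telescope (R : realType) (m n : nat) : (0 < m)%N -> (m <= n)%N ->
  \sum_(m.+1 <= d < n.+1) (d%:R ^+ 2)^-1 <= m%:R^-1 - n%:R^-1 :> R.
Proof.
move=> m0; elim: n => [|n IH]; first by rewrite leqn0 => /eqP ->;
  rewrite big_geq // subrr.
rewrite leq_eqVlt => /orP[/eqP ->|mn]; first by rewrite big_geq // subrr.
rewrite big_nat_recr //=; apply: (le_trans (lerD (IH mn) (lexx _))).
have n0 : 0 < n%:R :> R by rewrite ltr0n (leq_trans m0).
rewrite -natr1; move: (n%:R) n0 => y y0; move: (m%:R^-1) => x.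
have y1 : 0 < y + 1 by apply: addr_gt0.
rewrite -subr_ge0.
have -> : x - (y + 1)^-1 - (x - y^-1 + ((y + 1) ^+ 2)^-1) = (y * (y + 1) ^+ 2)^-1.
  by field; rewrite (gt_eqF y0) (gt_eqF y1).
by rewrite invr_ge0 mulr_ge0 ?exprn_ge0 // ltW.
Qed.

Lemma sum_inv_sqr_tail (R : realType) (m n : nat) : (0 < m)%N ->
  \sum_(m.+1 <= d < n) (d%:R ^+ 2)^-1 <= m%:R^-1 :> R.
Proof.
move=> m0; case: n => [|n]; first by rewrite big_geq // invr_ge0.
have [mn|nm] := leqP m n; last by rewrite big_geq ?invr_ge0 // ltnW.
apply: (le_trans (sum_inv_sqr_telescope _ m0 mn)).
by rewrite gerBl invr_ge0.
Qed.

(** The term [d = 2] contributes 1/4 and the telescoped tail at most 1/2. *)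
Lemma sum_inv_sqr_ge2 (R : realType) (n : nat) :
  \sum_(2 <= d < n) (d%:R ^+ 2)^-1 <= 3 / 4 :> R.
Proof.
have [n2|n2] := leqP n 2; first by rewrite big_geq // divr_ge0.
rewrite big_ltn //; have := @sum_inv_sqr_tail R 2 n isT.
move: (\sum_(_ <= _ < _) _) => x; lra.
Qed.

Lemma divn_le_div (R : realType) (n d : nat) : (n %/ d)%:R <= n%:R / d%:R :> R.
Proof.
have [->|d0] := posnP d; first by rewrite divn0 invr0 mulr0.
by rewrite ler_pdivlMr ?ltr0n // -natrM ler_nat leq_trunc_div.
Qed.

Lemma sqr_divn_le (R : realType) (n d : nat) :
  (n %/ d)%:R ^+ 2 <= n%:R ^+ 2 * (d%:R ^+ 2)^-1 :> R.
Proof.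
rewrite -expr_div_n lerXn2r ?nnegrE ?divr_ge0 //; exact: divn_le_div.
Qed.

Lemma cvgn_sqr_bounded (R : realType) (A : nat -> R) (a : R) :
  (A n / n%:R ^+ 2 @[n --> \oo] --> a) ->
  exists2 M, 0 <= M & forall n, (0 < n)%N -> `|A n| <= M * n%:R ^+ 2.
Proof.
move=> /cvgn_leP /(_ 1 ltr01)[N HN].
exists (`|a| + 1 + \sum_(0 <= k < N) `|A k|).
  by rewrite addr_ge0 ?addr_ge0 // sumr_ge0.
move=> n n0; have n2 : 1 <= n%:R ^+ 2 :> R by rewrite exprn_ege1 // ler1n.
have n20 : 0 < n%:R ^+ 2 :> R by apply: lt_le_trans n2.
have [Nn|nN] := leqP N n.
  rewrite -ler_pdivrMr // -[X in _ / X]gtr0_norm // -normf_div.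
  apply: (@le_trans _ _ (`|a| + 1)).
    by rewrite -lerBlDl (le_trans (lerB_dist _ _)) // HN.
  by rewrite lerDl sumr_ge0.
have An : `|A n| <= \sum_(0 <= k < N) `|A k|.
  by rewrite (bigD1_seq n) ?mem_index_iota ?iota_uniq //= lerDl sumr_ge0.
apply: (le_trans An); rewrite -[leLHS]mulr1 ler_pM // ?sumr_ge0 //.
by rewrite lerDr addr_ge0.
Qed.

Lemma ler_sum_scale_sqr (R : realType) (E : nat -> R) (M : R) (a b n : nat) :
  0 <= M ->
  (forall d, (a <= d < b)%N -> `|E (n %/ d)%N| <= M * (n %/ d)%:R ^+ 2) ->
  \sum_(a <= d < b) `|E (n %/ d)%N| <=
    M * n%:R ^+ 2 * \sum_(a <= d < b) (d%:R ^+ 2)^-1.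
Proof.
move=> M0 H; rewrite mulr_sumr big_nat_cond [leRHS]big_nat_cond.
apply: ler_sum => d /andP[dab _]; apply: (le_trans (H d dab)).
by rewrite -mulrA ler_wpM2l // sqr_divn_le.
Qed.

(* Since [\sum_(d >= 2) 1 / d ^ 2 <= 3 / 4 < 1], the recursion is a contraction
   for the supremum norm of [E n / n ^ 2]. *)
Lemma contraction_sqr (R : realType) (A E : nat -> R) :
  (forall n, (0 < n)%N ->
    `|E n| <= `|A n| + \sum_(2 <= d < n.+1) `|E (n %/ d)%N|) ->
  (A n / n%:R ^+ 2 @[n --> \oo] --> 0) ->
  E n / n%:R ^+ 2 @[n --> \oo] --> 0.
Proof.
move=> rec cA; have [A0 A00 hA] := cvgn_sqr_bounded cA.
(* A first bound by strong induction: [A0 + 3 / 4 * M <= M] as soon as [M >= 4 * A0]. *)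
have [M M0 hM] : exists2 M, 0 < M & forall n, (0 < n)%N -> `|E n| <= M * n%:R ^+ 2.
  exists (4 * A0 + 1); first by rewrite ltr_wpDl // mulr_ge0.
  elim/ltn_ind => n IH n0; apply: (le_trans (rec _ n0)).
  have h := @ler_sum_scale_sqr _ E (4 * A0 + 1) 2 n.+1 n.
  apply: (le_trans (lerD (hA _ n0) (h _ _))); first by rewrite addr_ge0 // mulr_ge0.
    move=> d /andP[d2 dn]; apply: IH; first by rewrite ltn_Pdiv.
    by rewrite divn_gt0 // ltnW.
  have := sum_inv_sqr_ge2 R n.+1; have := sqr_ge0 (n%:R : R).
  move: (\sum_(_ <= _ < _) _) (n%:R ^+ 2) => x y y0 x34.
  have : 0 <= (4 * A0 + 1) * y * (3 / 4 - x).
    by rewrite mulr_ge0 ?subr_ge0 // mulr_ge0 // addr_ge0 // mulr_ge0.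
  lra.
pose P m := exists N, forall n, (N <= n)%N -> `|E n| <= m * n%:R ^+ 2.
(* An eventual bound [m] improves to [7 / 8 * m]: the terms with [d <= D], where [n %/ d] is still
   large, contribute [3 / 4] of it, while [A] and the terms with [d > D], estimated by the first
   bound, contribute [1 / 16] each. *)
have step m : 0 < m -> P m -> P (7 / 8 * m).
  move=> m0 [N HN].
  have m16 : 0 < m / 16 by rewrite divr_gt0.
  have [N1 HN1] := (cvgn_leP _ _).1 cA _ m16.
  pose D := (Num.truncn (M / (m / 16))).+2.
  have D0 : (0 < D)%N by [].
  have DM : M * D%:R^-1 <= m / 16.
    rewrite ler_pdivrMr ?ltr0n // mulrC -ler_pdivrMr //.
    apply: ltW; apply: lt_trans (truncnS_gt _) _; rewrite ltr_nat //.
  exists (maxn N1 (D * N.+1)) => n; rewrite geq_max => /andP[N1n DNn].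
  have n0 : (0 < n)%N by apply: leq_trans DNn; rewrite muln_gt0.
  have n20 : 0 < n%:R ^+ 2 :> R by rewrite exprn_gt0 // ltr0n.
  have Dn : (D <= n)%N by apply: leq_trans DNn; rewrite leq_pmulr.
  have bA : `|A n| <= m / 16 * n%:R ^+ 2.
    by rewrite -ler_pdivrMr // -[X in _ / X]gtr0_norm // -normf_div -[X in
      `|X|]subr0 HN1.
  apply: (le_trans (rec _ n0)).
  rewrite (@big_cat_nat _ _ _ D.+1) //=.
  have h1 : \sum_(2 <= d < D.+1) `|E (n %/ d)%N| <= m * n%:R ^+ 2 * (3 / 4).
    apply: (le_trans (@ler_sum_scale_sqr _ E m 2 D.+1 n (ltW m0) _)).
      move=> d /andP[d2 dD]; apply: HN; rewrite leq_divRL; last by apply: ltnW.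
      by apply: leq_trans DNn; rewrite mulnC leq_mul.
    by rewrite ler_wpM2l ?sum_inv_sqr_ge2 // mulr_ge0 // ltW.
  have h2 : \sum_(D.+1 <= d < n.+1) `|E (n %/ d)%N| <= m / 16 * n%:R ^+ 2.
    apply: (le_trans (@ler_sum_scale_sqr _ E M D.+1 n.+1 n (ltW M0) _)).
      move=> d /andP[Dd dn]; apply: hM; rewrite divn_gt0 //.
      exact: leq_trans Dd.
    apply: (@le_trans _ _ (M * n%:R ^+ 2 * D%:R^-1)).
      by rewrite ler_wpM2l ?sum_inv_sqr_tail // mulr_ge0 // ltW.
    by rewrite mulrAC ler_wpM2r // ltW.
  have := lerD bA (lerD h1 h2); lra.
apply/cvgn_leP => e e0.
have PM k : P ((7 / 8) ^+ k * M).
  elim: k => [|k IH]; first by exists 1 => n n1; rewrite expr0 mul1r hM.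
  by rewrite exprS -mulrA; apply: step => //;
    rewrite mulr_gt0 // exprn_gt0 // divr_gt0.
have : (7 / 8 : R) ^+ k * M @[k --> \oo] --> 0 * M.
  by apply: cvgMl; apply: cvg_expr; rewrite ger0_norm; lra.
rewrite mul0r => /cvgn_leP /(_ _ e0)[k /(_ k (leqnn k))].
rewrite subr0 => /(le_trans (ler_norm _)) ke.
have [N HN] := PM k; exists N.+1 => n Nn; rewrite subr0 normf_div.
have n0 : 0 < n%:R ^+ 2 :> R by rewrite exprn_gt0 // ltr0n (leq_trans _ Nn).
rewrite [X in _ / X]gtr0_norm // ler_pdivrMr //.
by apply: (le_trans (HN _ (ltnW Nn))); rewrite ler_wpM2r // ltW.
Qed.

(** With [x = 1 / d] and [s = (n %/ d) / n], the left-hand side is [(x - s) (x + s)], where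
    [0 <= x - s <= 1 / n] and [x + s <= 2]. *)
Lemma sqr_divn_defect (R : realType) (n d : nat) : (0 < n)%N -> (0 < d)%N ->
  (d%:R ^+ 2)^-1 - (n %/ d)%:R ^+ 2 / n%:R ^+ 2 <= 2 / n%:R :> R.
Proof.
move=> n0 d0; set x : R := d%:R^-1; set y : R := n%:R^-1; set r : R := (n %/ d)%:R.
have y0 : 0 < y by rewrite invr_gt0 ltr0n.
have x0 : 0 < x by rewrite invr_gt0 ltr0n.
have x1 : x <= 1 by rewrite invf_le1 ?ltr0n // ler1n.
have r0 : 0 <= r by [].
have ryx : r * y <= x.
  by rewrite /y ler_pdivrMr ?ltr0n // mulrC; exact: divn_le_div.
have xry : x - r * y <= y.
  have nr : n%:R <= (r + 1) * d%:R :> R.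
    by rewrite natr1 -natrM ler_nat ltnW // ltn_ceil.
  have : n%:R * x * y <= (r + 1) * d%:R * x * y.
    by rewrite ler_wpM2r ?(ltW y0) // ler_wpM2r ?(ltW x0).
  have -> : n%:R * x * y = x by rewrite /y mulrAC mulfV ?mul1r // pnatr_eq0 -lt0n.
  have -> : (r + 1) * d%:R * x * y = (r + 1) * y.
    by rewrite /x mulfK // pnatr_eq0 -lt0n.
  move: x y r {x0 x1 y0 r0 ryx nr} => x y r; lra.
rewrite -!exprVn -/x -/y -exprMn subr_sqr.
have : 0 <= r * y by rewrite mulr_ge0 // ltW.
move: (r * y) ryx xry => s; nra.
Qed.

(** Dominated convergence for series: for [d <= D] the terms of the two sums differ by at most
    [2 / n], and for [d > D] both are dominated by [1 / d ^ 2], whose tail is at most [1 / D]. *)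
Lemma tannery_sqr (R : realType) (w : nat -> R) (Z : R) :
  (forall d, 0 <= w d <= 1) ->
  (\sum_(1 <= d < n.+1) w d / d%:R ^+ 2 @[n --> \oo] --> Z) ->
  (\sum_(1 <= d < n.+1) w d * (n %/ d)%:R ^+ 2) / n%:R ^+ 2 @[n --> \oo] --> Z.
Proof.
move=> w01 /cvgn_leP cw; apply/cvgn_leP => e e0.
have e3 : 0 < e / 3 by rewrite divr_gt0.
have [N HN] := cw _ e3.
pose D := (Num.truncn ((e / 3)^-1)).+1.
have De : D%:R^-1 <= e / 3 :> R.
  rewrite -[leRHS]invrK lef_pV2 ?posrE ?invr_gt0 ?ltr0n //.
  by apply: ltW; exact: truncnS_gt.
pose N' := (Num.truncn (2 * D%:R / (e / 3))).+1.
exists (maxn N (maxn D N')) => n; rewrite !geq_max => /and3P[Nn Dn N'n].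
have n0 : (0 < n)%N by apply: leq_trans Dn.
have Dne : 2 * D%:R / n%:R <= e / 3 :> R.
  rewrite ler_pdivrMr ?ltr0n // [leRHS]mulrC -ler_pdivrMr //.
  by apply: (le_trans (ltW (truncnS_gt _))); rewrite ler_nat.
have : `|(\sum_(1 <= d < n.+1) w d / d%:R ^+ 2) -
   (\sum_(1 <= d < n.+1) w d * (n %/ d)%:R ^+ 2) / n%:R ^+ 2| <= e / 3 + e / 3.
  rewrite mulr_suml -sumrB; apply: (le_trans (ler_norm_sum _ _ _)).
  pose g d : R := (d%:R ^+ 2)^-1 - (n %/ d)%:R ^+ 2 / n%:R ^+ 2.
  have g0 d : 0 <= g d.
    rewrite /g subr_ge0 ler_pdivrMr ?exprn_gt0 ?ltr0n // [leRHS]mulrC;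
      exact: sqr_divn_le.
  apply: (@le_trans _ _ (\sum_(1 <= d < n.+1) g d)).
    apply: ler_sum => d _; rewrite -mulrA -mulrBr -/(g d) normrM (ger0_norm (g0 d)).
    by have /andP[w0 w1] := w01 d; rewrite ger0_norm // ler_piMl.
  rewrite (@big_cat_nat _ _ _ D.+1) //= lerD //.
    apply: le_trans Dne.
    apply: (@le_trans _ _ (\sum_(1 <= d < D.+1) (2 / n%:R))).
      rewrite big_nat_cond [leRHS]big_nat_cond;
        apply: ler_sum => d /andP[/andP[d1 _] _].
      exact: sqr_divn_defect.
    by rewrite big_const_nat iter_addr_0 subn1 /= -[leLHS]mulr_natr mulrAC.
  apply: le_trans De; apply: le_trans (sum_inv_sqr_tail R n.+1 (isT : 0 < D)%N).
  by apply: ler_sum => d _; rewrite /g gerBl divr_ge0 // exprn_ge0.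
have := HN _ Nn; rewrite !ler_norml => /andP[a1 a2] /andP[b1 b2].
by apply/andP; split; lra.
Qed.

(** Subtracting [(a / Z) * n ^ 2] from [B] leaves a function [E] whose convolution with [w] is
    [o(n ^ 2)] by [tannery_sqr]. Since [w 1 = 1], solving for the term [d = 1] gives the recursion
    of [contraction_sqr]. *)
Lemma convolution_inverse_sqr (R : realType) (w A B : nat -> R) (a Z : R) :
  (forall d, 0 <= w d <= 1) -> w 1%N = 1 ->
  (\sum_(1 <= d < n.+1) w d / d%:R ^+ 2 @[n --> \oo] --> Z) ->
  (forall n, A n = \sum_(1 <= d < n.+1) w d * B (n %/ d)%N) ->
  (A n / n%:R ^+ 2 @[n --> \oo] --> a) -> 0 < Z ->
  B n / n%:R ^+ 2 @[n --> \oo] --> a / Z.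
Proof.
move=> w01 w1 cw AE cA Z0; set L := a / Z.
pose E n := B n - L * n%:R ^+ 2.
pose V n := \sum_(1 <= d < n.+1) w d * (n %/ d)%:R ^+ 2.
pose A' n := A n - L * V n.
have cA' : A' n / n%:R ^+ 2 @[n --> \oo] --> 0.
  have -> : (fun n => A' n / n%:R ^+ 2) =
      (fun n => A n / n%:R ^+ 2 - L * (V n / n%:R ^+ 2)).
    by apply/funext => n; rewrite /A' mulrBl mulrA.
  have -> : 0 = a - L * Z :> R by rewrite /L divfK ?subrr // gt_eqF.
  by apply: cvgB => //; apply: cvgMr; exact: tannery_sqr.
have cE : E n / n%:R ^+ 2 @[n --> \oo] --> 0.
  apply: contraction_sqr cA' => n n0.
  have A'E : A' n = \sum_(1 <= d < n.+1) w d * E (n %/ d)%N.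
    rewrite /A' AE /V mulr_sumr -sumrB; apply: eq_bigr => d _; rewrite /E; ring.
  have -> : E n = A' n - \sum_(2 <= d < n.+1) w d * E (n %/ d)%N.
    by rewrite A'E big_ltn // divn1 w1 mul1r addrK.
  apply: (le_trans (ler_normB _ _)); rewrite lerD2l.
  apply: (le_trans (ler_norm_sum _ _ _)); apply: ler_sum => d _.
  by have /andP[h0 h1] := w01 d; rewrite normrM ger0_norm // ler_piMl.
have : E n / n%:R ^+ 2 + L @[n --> \oo] --> 0 + L by apply: cvgD => //;
  exact: cvg_cst.
rewrite add0r; apply: cvg_trans; apply: near_eq_cvg; exists 1%N => // n /= n1.
by rewrite /E mulrBl mulfK ?subrK // sqrf_eq0 pnatr_eq0 -lt0n.
Qed.

(** * Sums over integers with prescribed prime divisors *)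

Lemma sum_multiples (V : nmodType) (h : nat -> V) (d n : nat) : (0 < d)%N ->
  \sum_(1 <= q < n.+1 | (d %| q)%N) h q = \sum_(1 <= m < (n %/ d).+1) h (m * d)%N.
Proof.
move=> d0; elim: n => [|n IH]; first by rewrite div0n !big_geq.
rewrite big_mkcond big_nat_recr //= -big_mkcond IH divnS //.
case: ifPn => dn; last by rewrite addr0.
rewrite [in RHS]big_nat_recr //=; congr (_ + h _).
by have := divnK dn; rewrite divnS // dn add1n.
Qed.

(** Both sides run over the pairs with [m * d <= n]. *)
Lemma exchange_hyperbola (V : nmodType) (F : nat -> nat -> V) (n : nat) :
  \sum_(1 <= d < n.+1) \sum_(1 <= m < (n %/ d).+1) F m d =
  \sum_(1 <= m < n.+1) \sum_(1 <= d < (n %/ m).+1) F m d.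
Proof.
have widen (G : nat -> V) d : (0 < d)%N -> \sum_(1 <= m < (n %/ d).+1) G m =
    \sum_(1 <= m < n.+1 | (m * d <= n)%N) G m.
  move=> d0; rewrite (big_nat_widen 1 _ n.+1) ?ltnS ?leq_div //.
  by apply: eq_bigl => m; rewrite ltnS leq_divRL.
rewrite big_nat (eq_bigr (fun d => \sum_(1 <= m < n.+1 | (m * d <= n)%N) F m d));
  last first.
  by move=> d /andP[d1 _]; rewrite widen.
rewrite -big_nat (exchange_big_dep xpredT) //= big_nat [RHS]big_nat.
apply: eq_bigr => m /andP[m1 _]; rewrite widen //.
by apply: eq_bigl => d; rewrite mulnC.
Qed.

Definition avoids (l : seq nat) (n : nat) : bool := all (fun p => ~~ (p %| n)%N) l.

Lemma avoidsM (l : seq nat) (m n : nat) : all prime l ->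
  avoids l (m * n) = avoids l m && avoids l n.
Proof.
rewrite /avoids -all_predI; elim: l => //= p l IH /andP[pp /IH ->].
by rewrite Euclid_dvdM // negb_or.
Qed.

Lemma avoids_prime (l : seq nat) (p : nat) : prime p -> all prime l ->
  p \notin l -> avoids l p.
Proof.
move=> pp /allP pl pnl; apply/allP => r rl; have pr := pl _ rl.
by rewrite dvdn_prime2 //; apply/eqP => rp; rewrite -rp rl in pnl.
Qed.

(** The indicator of [avoids l] is completely multiplicative, so it distributes over the convolution
    [f = 1 * g] before the sum over [q = m * d] is reordered. *)
Lemma convolution_avoids (R : realType) (l : seq nat) (f g : nat -> R) (n : nat) :
  all prime l ->
  (forall q, (0 < q)%N -> f q = \sum_(d <- divisors q) g d) ->
  \sum_(1 <= q < n.+1 | avoids l q) f q =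
  \sum_(1 <= m < n.+1)
    (avoids l m)%:R * \sum_(1 <= d < (n %/ m).+1 | avoids l d) g d.
Proof.
move=> pl fg.
transitivity (\sum_(1 <= q < n.+1 | avoids l q)
    \sum_(1 <= d < n.+1 | (d %| q)%N) g d).
  rewrite big_nat_cond [RHS]big_nat_cond; apply: eq_bigr => q /andP[/andP[q1 qn] _].
  rewrite fg // -[RHS]big_filter; apply: perm_big; apply: uniq_perm.
  - exact: divisors_uniq.
  - by rewrite filter_uniq // iota_uniq.
  - move=> d; rewrite mem_filter mem_index_iota -dvdn_divisors //.
    case: (boolP (d %| q)%N) => //= dq.
    by rewrite (dvdn_gt0 q1 dq) ltnS (leq_trans (dvdn_leq q1 dq)).
rewrite (exchange_big_dep xpredT) //=.
rewrite big_nat (eq_bigr (fun d => \sum_(1 <= m < (n %/ d).+1)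
    (avoids l m)%:R * ((avoids l d)%:R * g d))); last first.
  move=> d /andP[d1 _].
  rewrite [RHS](eq_bigr (fun m => (fun q =>
    (avoids l (q %/ d))%:R * ((avoids l d)%:R * g d)) (m * d)%N)); last first.
    by move=> m _; rewrite mulnK.
  rewrite -(sum_multiples (fun q =>
    (avoids l (q %/ d))%:R * ((avoids l d)%:R * g d))) //.
  rewrite big_mkcond [RHS]big_mkcond; apply: eq_bigr => q _.
  rewrite andbC; case: (boolP (d %| q)%N) => //= dq.
  rewrite -{1}(divnK dq) avoidsM //.
  by case: avoids; case: avoids; rewrite ?mul1r ?mul0r ?mulr0.
rewrite -big_nat exchange_hyperbola; apply: eq_bigr => m _.
rewrite mulr_sumr [RHS]big_mkcond; apply: eq_bigr => d _.
by case: (avoids l d); rewrite ?mul1r ?mul0r ?mulr0.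
Qed.

Lemma cvg_divn (R : realType) (p : nat) (u : nat -> R) (l : R) : (0 < p)%N ->
  (u n @[n --> \oo] --> l) -> u (n %/ p)%N @[n --> \oo] --> l.
Proof.
move=> p0 /cvgn_leP cu; apply/cvgn_leP => e /cu[N HN].
by exists (N * p)%N => n Nn; apply: HN; rewrite leq_divRL.
Qed.

Lemma cvg_invn_mul (R : realType) (c : R) : c / n%:R @[n --> \oo] --> 0.
Proof.
apply/cvgn_leP => e e0; exists (Num.truncn (`|c| / e)).+1 => n Nn.
have n0 : (0 < n)%N by apply: leq_trans Nn.
rewrite subr0 normf_div [X in _ / X]ger0_norm // ler_pdivrMr ?ltr0n //.
rewrite mulrC -ler_pdivrMr //; apply: (le_trans (ltW (truncnS_gt _))).
by rewrite ler_nat.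
Qed.

Lemma cvg_sqr_divn (R : realType) (p : nat) : (0 < p)%N ->
  (n %/ p)%:R ^+ 2 / n%:R ^+ 2 @[n --> \oo] --> ((p%:R ^+ 2)^-1 : R).
Proof.
move=> p0; apply/cvgn_leP => e e0.
have /cvgn_leP/(_ _ e0)[N HN] := cvg_invn_mul (2 : R).
exists N.+1 => n Nn; have n0 : (0 < n)%N by apply: leq_trans Nn.
rewrite distrC ger0_norm.
  apply: (le_trans (sqr_divn_defect _ n0 p0)); have := HN n (ltnW Nn).
  by rewrite subr0; apply: le_trans; exact: ler_norm.
by rewrite subr_ge0 ler_pdivrMr ?exprn_gt0 ?ltr0n // [leRHS]mulrC sqr_divn_le.
Qed.

Lemma cvg_sqr_divn_comp (R : realType) (p : nat) (A : nat -> R) (a : R) :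
  (0 < p)%N -> (A n / n%:R ^+ 2 @[n --> \oo] --> a) ->
  A (n %/ p)%N / n%:R ^+ 2 @[n --> \oo] --> a / p%:R ^+ 2.
Proof.
move=> p0 cA.
have : A (n %/ p)%N / (n %/ p)%:R ^+ 2 * ((n %/ p)%:R ^+ 2 / n%:R ^+ 2)
    @[n --> \oo] --> a * (p%:R ^+ 2)^-1.
  apply: cvgM (cvg_sqr_divn p0).
  exact: (cvg_divn (u := fun n => A n / n%:R ^+ 2)).
apply: cvg_trans; apply: near_eq_cvg; exists p => // n /= pn.
rewrite mulrA mulfVK // sqrf_eq0 pnatr_eq0 -lt0n divn_gt0 //.
Qed.

(** The multiples of [p] that avoid [l] are the [m * p] with [m] avoiding [l], because [p] is a
    prime outside [l]. *)
Lemma sum_avoids_cons (V : zmodType) (h : nat -> V) (l : seq nat) (p n : nat) :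
  prime p -> all prime l -> p \notin l ->
  \sum_(1 <= q < n.+1 | avoids (p :: l) q) h q =
  \sum_(1 <= q < n.+1 | avoids l q) h q -
  \sum_(1 <= m < (n %/ p).+1 | avoids l m) h (m * p)%N.
Proof.
move=> pp pl npl; rewrite [X in _ = X - _](bigID (dvdn p)) /=.
suff -> : \sum_(1 <= m < (n %/ p).+1 | avoids l m) h (m * p)%N =
    \sum_(1 <= q < n.+1 | avoids l q && (p %| q)%N) h q.
  rewrite [X in _ = X - _]addrC addrK; apply: eq_bigl => q; exact: andbC.
rewrite big_mkcond.
rewrite (eq_bigr (fun m => (fun q => if avoids l q then h q else 0) (m * p)%N)).
  rewrite -(sum_multiples (fun q =>
    if avoids l q then h q else 0)) ?prime_gt0 // -big_mkcondr;
      apply: eq_bigl => q; exact: andbC.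
by move=> m _; rewrite avoidsM // (avoids_prime pp) // andbT.
Qed.

(** Removing the multiples of [p] subtracts [p] times the sum up to [n %/ p], asymptotically the
    fraction [p / p ^ 2] of the whole. *)
Lemma sum_avoids_id_cvg (R : realType) (l : seq nat) : uniq l -> all prime l ->
  (\sum_(1 <= q < n.+1 | avoids l q) q%:R) / n%:R ^+ 2 @[n --> \oo] -->
  (2^-1 * \prod_(p <- l) (1 - p%:R^-1) : R).
Proof.
elim: l => [_ _|p l IH /= /andP[npl ul] /andP[pp pl]].
  rewrite big_nil mulr1.
  have cv : 2^-1 + 2^-1 / n%:R @[n --> \oo] --> (2^-1 + 0 : R).
    by apply: cvgD; [exact: cvg_cst | exact: cvg_invn_mul].
  rewrite addr0 in cv; apply: cvg_trans cv; apply: near_eq_cvg.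
  exists 1%N => // n /= n1.
  have -> : \sum_(1 <= q < n.+1 | avoids [::] q) q%:R = n%:R * (n%:R + 1) / 2 :> R.
    rewrite (eq_bigl xpredT) //; elim: n {n1} => [|n IH].
      by rewrite big_geq // mul0r mul0r.
    by rewrite big_nat_recr //= IH -natr1; field.
  have n0 : n%:R != 0 :> R by rewrite pnatr_eq0 -lt0n.
  by field.
have p0 := prime_gt0 pp.
under eq_fun => n do rewrite (sum_avoids_cons _ n pp pl npl).
have -> : (fun n : nat => (\sum_(1 <= q < n.+1 | avoids l q) q%:R -
     \sum_(1 <= m < (n %/ p).+1 | avoids l m) (m * p)%:R) / n%:R ^+ 2 : R) =
  (fun n => (\sum_(1 <= q < n.+1 | avoids l q) q%:R) / n%:R ^+ 2 -
     (fun k => \sum_(1 <= m < k.+1 | avoids l m) m%:R) (n %/ p)%N / n%:R ^+ 2 *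
       p%:R).
  apply/funext => n; rewrite mulrBl; congr (_ - _).
  by rewrite mulrAC; congr (_ * _); rewrite mulr_suml; apply: eq_bigr => m _;
    rewrite natrM.
have {}IH := IH ul pl.
rewrite big_cons; set K := 2^-1 * _ in IH.
have -> : 2^-1 * ((1 - p%:R^-1) * \prod_(j <- l) (1 - j%:R^-1)) =
  K - K / p%:R ^+ 2 * p%:R :> R.
  by rewrite /K; field; rewrite pnatr_eq0 -lt0n.
apply: cvgB => //; apply: cvgMl.
exact: (cvg_sqr_divn_comp (A := fun k => \sum_(1 <= m < k.+1 | avoids l m) m%:R)).
Qed.

Lemma sum_inv_sqr_cvg (R : realType) :
  exists2 Z : R, 0 < Z & \sum_(1 <= d < n.+1) (d%:R ^+ 2)^-1 @[n --> \oo] --> Z.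
Proof.
pose u n : R := \sum_(1 <= d < n.+1) (d%:R ^+ 2)^-1.
have und : nondecreasing_seq u.
  apply/nondecreasing_seqP => n; rewrite /u [leRHS]big_nat_recr //= lerDl.
  by rewrite invr_ge0 exprn_ge0.
have ub : has_ubound (range u).
  exists (1 + 3 / 4) => _ [n _ <-]; rewrite /u; case: n => [|n].
    by rewrite big_geq //; lra.
  by rewrite big_ltn // expr1n invr1 lerD2l sum_inv_sqr_ge2.
have cu := nondecreasing_is_cvgn und ub.
exists (limn u) => //; apply: lt_le_trans (nondecreasing_cvgn_le und cu 1%N).
by rewrite /u big_nat1 expr1n invr1.
Qed.

(** Here [Z] is zeta(2), and each prime of [l] removes its Euler factor. *)
Lemma sum_avoids_inv_sqr_cvg (R : realType) (Z : R) (l : seq nat) :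
  (\sum_(1 <= d < n.+1) (d%:R ^+ 2)^-1 @[n --> \oo] --> Z) ->
  uniq l -> all prime l ->
  \sum_(1 <= d < n.+1 | avoids l d) (d%:R ^+ 2)^-1 @[n --> \oo] -->
  Z * \prod_(p <- l) (1 - (p%:R ^+ 2)^-1).
Proof.
move=> cZ; elim: l => [_ _|p l IH /= /andP[npl ul] /andP[pp pl]].
  rewrite big_nil mulr1; apply: cvg_trans cZ; apply: near_eq_cvg.
  by exists 0%N => // n _; apply: eq_bigl.
have p0 := prime_gt0 pp.
under eq_fun => n do rewrite (sum_avoids_cons _ n pp pl npl).
have -> : (fun n : nat => \sum_(1 <= q < n.+1 | avoids l q) (q%:R ^+ 2)^-1 -
     \sum_(1 <= m < (n %/ p).+1 | avoids l m) ((m * p)%:R ^+ 2)^-1 : R) =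
  (fun n => \sum_(1 <= q < n.+1 | avoids l q) (q%:R ^+ 2)^-1 -
     (fun k => \sum_(1 <= m < k.+1 | avoids l m) (m%:R ^+ 2)^-1) (n %/ p)%N * (p%:R
       ^+ 2)^-1).
  apply/funext => n; congr (_ - _); rewrite mulr_suml; apply: eq_bigr => m _.
  by rewrite natrM exprMn invfM.
have {}IH := IH ul pl; rewrite big_cons mulrCA mulrBl mul1r.
rewrite [X in _ - X]mulrC; apply: cvgB => //; apply: cvgMl.
exact: (cvg_divn (u := fun k => \sum_(1 <= m < k.+1 | avoids l m) (m%:R ^+ 2)^-1)).
Qed.

Lemma natr_sum_totient (R : realType) (q : nat) : (0 < q)%N ->
  q%:R = \sum_(d <- divisors q) (totient d)%:R :> R.
Proof.
move=> q0; rewrite -[in LHS](sum_totient_dvd q) -natr_sum.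
rewrite -(big_mkord (fun d => d %| q)%N totient) -big_filter; congr (_%:R).
apply: perm_big; apply: uniq_perm;
  rewrite ?filter_uniq ?iota_uniq ?divisors_uniq //.
move=> d; rewrite mem_filter mem_index_iota -dvdn_divisors //.
by case: (boolP (d %| q)%N) => //= dq; rewrite ltnS dvdn_leq.
Qed.

Lemma mkcond_avoids (R : realType) (l : seq nat) (n : nat) :
  \sum_(1 <= d < n.+1) (avoids l d)%:R / d%:R ^+ 2 =
  \sum_(1 <= d < n.+1 | avoids l d) (d%:R ^+ 2)^-1 :> R.
Proof.
by rewrite [RHS]big_mkcond; apply: eq_bigr => d _; case: avoids;
  rewrite ?mul1r ?mul0r.
Qed.

Lemma prod_one_sub_gt0 (R : realType) (l : seq nat) : all prime l ->
  0 < \prod_(p <- l) (1 - (p%:R ^+ 2)^-1) :> R.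
Proof.
move=> /allP pl; rewrite big_seq; apply: prodr_gt0 => p /pl /prime_gt1 p1.
rewrite subr_gt0 invf_lt1 ?exprn_gt0 ?ltr0n ?(ltnW p1) //.
by rewrite exprn_egt1 // ltr1n.
Qed.

(* Among primitive characters ordered by conductor, the proportion of those
   whose conductor is divisible by [p]. *)
Definition dens (R : realType) (p : nat) : R :=
  (p%:R ^+ 2 - p%:R - 1) / ((p%:R + 1) ^+ 2 * (p%:R - 1)).
Arguments dens R p : clear implicits.

(** The left-hand side is the local factor at an avoided prime: [1 - 1 / p] from the sum of the
    integers, divided by [1 - 1 / p ^ 2] once for each of the two inversions. *)
Lemma dens_compl (R : realType) (p : nat) : prime p ->
  (1 - p%:R^-1) / (1 - (p%:R ^+ 2)^-1) ^+ 2 = 1 - dens R p.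
Proof.
move=> /prime_gt1 p1; rewrite /dens.
have : 1 < p%:R :> R by rewrite ltr1n.
move: (p%:R) => x x1; field.
have h1 : x != 0 by lra.
have h2 : x + 1 != 0 by lra.
have h3 : x - 1 != 0 by lra.
have h4 : x ^+ 2 - 1 != 0 by rewrite (_ : x ^+ 2 - 1 =
  (x - 1) * (x + 1)) ?mulf_neq0 //; ring.
by rewrite ?h1 ?h2 ?h3 ?h4.
Qed.

(** Two inversions, of [id = 1 * totient] and of [totient = 1 * s], restricted to the integers that
    avoid [l]; each divides the limit by [W], the restricted zeta(2). *)
Lemma sum_avoids_cvg (R : realType) (Z : R) (s : nat -> R) (l : seq nat) :
  (\sum_(1 <= d < n.+1) (d%:R ^+ 2)^-1 @[n --> \oo] --> Z) -> 0 < Z ->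
  (forall q, (0 < q)%N -> (totient q)%:R = \sum_(d <- divisors q) s d) ->
  uniq l -> all prime l ->
  (\sum_(1 <= q < n.+1 | avoids l q) s q) / n%:R ^+ 2 @[n --> \oo] -->
  (2 * Z ^+ 2)^-1 * \prod_(p <- l) (1 - dens R p).
Proof.
move=> cZ Z0 hs ul pl.
have w01 d : 0 <= ((avoids l d)%:R : R) <= 1 by case: avoids; rewrite ?lexx ?ler01.
have w1 : (avoids l 1)%:R = 1 :> R.
  suff -> : avoids l 1 by [].
  by apply/allP => p /(allP pl) /prime_gt1 p1; rewrite dvdn1 gtn_eqF.
set W := Z * \prod_(p <- l) (1 - (p%:R ^+ 2)^-1).
have W0 : 0 < W by rewrite mulr_gt0 // prod_one_sub_gt0.
have cW : \sum_(1 <= d < n.+1) (avoids l d)%:R / d%:R ^+ 2 @[n --> \oo] --> W.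
  under eq_fun => n do rewrite mkcond_avoids.
  exact: sum_avoids_inv_sqr_cvg.
have c1 := sum_avoids_id_cvg (R:=R) ul pl.
have c2 := convolution_inverse_sqr
  (B := fun n => \sum_(1 <= q < n.+1 | avoids l q) (totient q)%:R) w01 w1 cW
  (fun n => convolution_avoids n pl (@natr_sum_totient R)) c1 W0.
have c3 := convolution_inverse_sqr
  (B := fun n => \sum_(1 <= q < n.+1 | avoids l q) s q) w01 w1 cW
  (fun n => convolution_avoids n pl hs) c2 W0.
have -> : (2 * Z ^+ 2)^-1 * \prod_(p <- l) (1 - dens R p) =
   2^-1 * \prod_(p <- l) (1 - p%:R^-1) / W / W.
  rewrite big_seq; under eq_bigr => p hp do rewrite -dens_compl ?(allP pl) //.
  rewrite -big_seq prodf_div prodrXl -/W.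
  have := prod_one_sub_gt0 R pl; rewrite /W;
    move: (\prod_(_ <- _) _) (\prod_(_ <- _) _) => x y y0.
  by field; rewrite !gt_eqF.
exact: c3.
Qed.

Definition multiple_of_all (P : seq nat) (n : nat) : bool := all (fun p =>
  p %| n)%N P.

(** Induction on [P]: the multiples of [p] are all integers minus those that avoid [p], so [p] moves
    to [l] and its factor is [1 - (1 - dens R p)]. *)
Lemma sum_multiple_avoids_cvg (R : realType) (Z : R) (s : nat -> R) (P l : seq nat)
  :
  (\sum_(1 <= d < n.+1) (d%:R ^+ 2)^-1 @[n --> \oo] --> Z) -> 0 < Z ->
  (forall q, (0 < q)%N -> (totient q)%:R = \sum_(d <- divisors q) s d) ->
  uniq (P ++ l) -> all prime (P ++ l) ->
  (\sum_(1 <= q < n.+1 | multiple_of_all P q && avoids l q) s q) / n%:R ^+ 2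
    @[n --> \oo] -->
  (2 * Z ^+ 2)^-1 * (\prod_(p <- P) dens R p * \prod_(p <- l) (1 - dens R p)).
Proof.
move=> cZ Z0 hs; elim: P l => [|p P IH] l; rewrite ?cat0s.
  move=> ul pl; rewrite big_nil mul1r; exact: sum_avoids_cvg.
rewrite cat_cons => up ap.
have c1 : uniq (P ++ l) by case/andP: up.
have c2 : all prime (P ++ l) by case/andP: ap.
have c3 : uniq (P ++ p :: l) by rewrite -cat_rcons -(perm_uniq (s1 :=
  p :: P ++ l)) // -cat_cons perm_cat2r perm_sym perm_rcons.
have c4 : all prime (P ++ p :: l) by rewrite all_cat /= andbCA -all_cat.
have -> : (2 * Z ^+ 2)^-1 * (\prod_(p <- (p :: P)) dens R p * \prod_(p <- l) (1 -
  dens R p)) =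
   (2 * Z ^+ 2)^-1 * (\prod_(p <- P) dens R p * \prod_(p <- l) (1 - dens R p)) -
   (2 * Z ^+ 2)^-1 * (\prod_(p <- P) dens R p * \prod_(p <- p :: l) (1 - dens R p)).
  rewrite !big_cons; ring.
have -> : (fun n : nat =>
  (\sum_(1 <= q < n.+1 | multiple_of_all (p :: P) q && avoids l q) s q) / n%:R ^+ 2
    : R) =
   (fun n => (\sum_(1 <= q < n.+1 | multiple_of_all P q && avoids l q) s q) / n%:R
     ^+ 2 -
   (\sum_(1 <= q < n.+1 | multiple_of_all P q && avoids (p :: l) q) s q) / n%:R ^+
     2).
  apply/funext => n; rewrite -mulrBl; congr (_ / _).
  rewrite [X in _ = X - _](bigID (dvdn p)) /=.
  rewrite (eq_bigl (fun q => multiple_of_all P q && avoids l q && (p %| q)%N));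
    last first.
    by move=> q /=; rewrite -andbA andbC.
  rewrite [X in _ = _ - X](eq_bigl (fun q =>
    multiple_of_all P q && avoids l q && ~~ (p %| q)%N)) ?addrK //.
  by move=> q /=; rewrite -andbA [X in _ && X]andbC.
by apply: cvgB; exact: IH.
Qed.

Local Open Scope complex_scope.

(** * Dirichlet characters *)

Lemma dchar_perz (R : realType) (q : nat) (chi : int -> R[i]) (a k : int) :
  dirichlet_character q chi -> chi (a + k * q%:Z) = chi a.
Proof.
move=> [per _ _].
have perk b (j : nat) : chi (b + j%:Z * q%:Z) = chi b.
  elim: j => [|j IH]; first by rewrite mul0r addr0.
  by rewrite intS mulrDl mul1r addrCA addrC per.
case: k => k; first exact: perk.
by rewrite -(perk _ k.+1) NegzE mulNr subrK.
Qed.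

Lemma dchar_modz (R : realType) (q : nat) (chi : int -> R[i]) (a : int) :
  dirichlet_character q chi -> chi (a %% q%:Z)%Z = chi a.
Proof.
by move=> dc; rewrite [in RHS](divz_eq a q%:Z) addrC (dchar_perz _ _ dc).
Qed.

Lemma dchar_eqmod (R : realType) (q : nat) (chi : int -> R[i]) (a b : int) :
  dirichlet_character q chi -> (a = b %[mod q%:Z])%Z -> chi a = chi b.
Proof. by move=> dc ab; rewrite -(dchar_modz a dc) ab dchar_modz. Qed.

Lemma dchar_modn (R : realType) (q : nat) (chi : int -> R[i]) (n : nat) :
  dirichlet_character q chi -> chi (n %% q)%N%:Z = chi n%:Z.
Proof. by move=> dc; rewrite -modz_nat dchar_modz. Qed.

Lemma dchar_neq0 (R : realType) (q : nat) (chi : int -> R[i]) (n : nat) :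
  dirichlet_character q chi -> (chi n%:Z != 0) = coprime n q.
Proof. by move=> [_ _ ->]; rewrite coprimezE !absz_nat. Qed.

Lemma dchar_eq0 (R : realType) (q : nat) (chi : int -> R[i]) (a : int) :
  dirichlet_character q chi -> ~~ coprimez a q%:Z -> chi a = 0.
Proof. by move=> [_ _ <-] /negPn/eqP. Qed.

Lemma dchar1 (R : realType) (q : nat) (chi : int -> R[i]) :
  dirichlet_character q chi -> chi 1 = 1.
Proof.
move=> [_ mul cop]; have n0 : chi 1 != 0 by rewrite cop coprimezE coprime1n.
by apply: (mulfI n0); rewrite -mul !mulr1.
Qed.

Lemma dchar_mulz (R : realType) (q : nat) (chi : int -> R[i]) (a b : int) :
  dirichlet_character q chi -> chi (a * b) = chi a * chi b.
Proof. by case. Qed.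

Lemma dchar_muln (R : realType) (q : nat) (chi : int -> R[i]) (m n : nat) :
  dirichlet_character q chi -> chi (m * n)%N%:Z = chi m%:Z * chi n%:Z.
Proof. by move=> dc; rewrite PoszM (dchar_mulz _ _ dc). Qed.

Lemma dcharX (R : realType) (q : nat) (chi : int -> R[i]) (m n : nat) :
  dirichlet_character q chi -> chi (m ^ n)%N%:Z = chi m%:Z ^+ n.
Proof.
move=> dc; elim: n => [|n IH]; first by rewrite expn0 expr0 (dchar1 dc).
by rewrite expnS exprS (dchar_muln _ _ dc) IH.
Qed.

Lemma dchar_absz (R : realType) (q : nat) (chi : int -> R[i]) (a : int) :
  (0 < q)%N -> dirichlet_character q chi ->
  exists2 n : nat, (n < q)%N & chi a = chi n%:Z.
Proof.
move=> q0 dc; have q0z : q%:Z != 0 by rewrite eqz_nat -lt0n.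
have := modz_ge0 a q0z; have := ltz_pmod a (_ : 0 < q%:Z).
rewrite -(dchar_modz a dc).
by case: (a %% q%:Z)%Z => // m /(_ q0) lmq _; exists m.
Qed.

Lemma dchar_norm (R : realType) (q : nat) (chi : int -> R[i]) (n : nat) :
  (0 < q)%N -> dirichlet_character q chi ->
  `|chi n%:Z| = (coprime n q)%:R.
Proof.
move=> q0 dc; have [cnq|ncnq] := boolP (coprime n q); last first.
  by apply/eqP; rewrite normr_eq0 -[_ == 0]negbK (dchar_neq0 _ dc).
apply/eqP; rewrite -(@pexpr_eq1 _ _ (totient q)) ?totient_gt0 //.
rewrite -normrX -(dcharX _ _ dc) -(dchar_modn _ dc) Euler_exp_totient //.
by rewrite (dchar_modn _ dc) (dchar1 dc) normr1.
Qed.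

Lemma dchar_mul_conj (R : realType) (q : nat) (chi : int -> R[i]) (n : nat) :
  (0 < q)%N -> dirichlet_character q chi ->
  chi n%:Z * (chi n%:Z)^*%R = (coprime n q)%:R.
Proof.
by move=> q0 dc; rewrite -normCK (dchar_norm _ q0 dc); case: coprime;
  rewrite ?expr1n ?expr0n.
Qed.

Lemma dchar_ext (R : realType) (q : nat) (chi psi : int -> R[i]) :
  (0 < q)%N -> dirichlet_character q chi -> dirichlet_character q psi ->
  (forall n : nat, coprime n q -> chi n%:Z = psi n%:Z) -> chi = psi.
Proof.
move=> q0 dc dp eq; apply/funext => a.
have q0z : q%:Z != 0 by rewrite eqz_nat -lt0n.
have := modz_ge0 a q0z; rewrite -(dchar_modz a dc) -(dchar_modz a dp).
case: (a %% q%:Z)%Z => // m _.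
have [/eq //|ncnq] := boolP (coprime m q).
by rewrite !(@dchar_eq0 _ q) // coprimezE.
Qed.

(** The coprimality hypothesis is phrased to serve both [q = q1 = q2] and [q = q1 * q2]. *)
Lemma dchar_mul_conjc (R : realType) (q q1 q2 : nat) (chi1 chi2 : int -> R[i]) :
  (q1 %| q)%N -> (q2 %| q)%N ->
  (forall a, coprimez a q%:Z = coprimez a q1%:Z && coprimez a q2%:Z) ->
  dirichlet_character q1 chi1 -> dirichlet_character q2 chi2 ->
  dirichlet_character q (fun a => chi1 a * (chi2 a)^*%R).
Proof.
move=> /dvdnP[k1 E1] /dvdnP[k2 E2] cop d1 d2; split => [a|a b|a].
- congr (_ * _^*%R); first by rewrite E1 PoszM (dchar_perz _ _ d1).
  by rewrite E2 PoszM (dchar_perz _ _ d2).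
- by rewrite (dchar_mulz _ _ d1) (dchar_mulz _ _ d2) rmorphM mulrACA.
- case: d1 d2 => _ _ c1 [_ _ c2].
  by rewrite mulf_eq0 negb_or conjC_eq0 c1 c2 cop.
Qed.

Lemma dchar_mul_conjc_nonprincipal (R : realType) (q1 q2 n : nat)
    (chi1 chi2 : int -> R[i]) :
  (0 < q2)%N -> dirichlet_character q1 chi1 -> dirichlet_character q2 chi2 ->
  coprime n q1 -> coprime n q2 -> chi1 n%:Z != chi2 n%:Z ->
  nonprincipal (fun a => chi1 a * (chi2 a)^*%R).
Proof.
move=> q20 d1 d2 c1 c2 neq; exists n%:Z; split.
  by rewrite mulf_eq0 negb_or conjC_eq0 (dchar_neq0 _ d1) (dchar_neq0 _ d2) c1.
apply: contraNneq neq => e1; apply/eqP.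
have := dchar_mul_conj n q20 d2; rewrite c2 => e2.
have z2 : (chi2 n%:Z)^*%R != 0 by rewrite conjC_eq0 (dchar_neq0 _ d2).
by apply: (mulIf z2); rewrite e1 e2.
Qed.

(** Multiplication by some [a] with [chi a] outside {0, 1} permutes the residues, so the sum [S]
    satisfies [chi a * S = S]. *)
Lemma dchar_sum0 (R : realType) (q : nat) (chi : int -> R[i]) :
  (0 < q)%N -> dirichlet_character q chi -> nonprincipal chi ->
  \sum_(0 <= n < q) chi n%:Z = 0.
Proof.
move=> q0 dc [a0 []].
have [a _ ->] := dchar_absz a0 q0 dc; rewrite (dchar_neq0 _ dc) => caq a1.
rewrite big_mkord; set S := \sum_(_ < _) _.
have : chi a%:Z * S = S.
  pose h (n : 'I_q) : 'I_q := Ordinal (ltn_pmod (a * n) q0).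
  have hinj : injective h.
    move=> m n [] /eqP.
    move=> H; apply/val_inj => /=.
    wlog mn : m n H / (m <= n)%N.
      by move=> hw; case: (leqP m n) => [/hw|/ltnW /hw] -> //; rewrite eq_sym.
    move: H; rewrite eq_sym eqn_mod_dvd ?leq_mul2l ?mn ?orbT //.
    rewrite -mulnBr Gauss_dvdr 1?coprime_sym // => /dvdn_leq.
    have := ltn_ord n; lia.
  rewrite /S mulr_sumr [RHS](reindex_inj hinj) /=; apply: eq_bigr => n _.
  by rewrite (dchar_modn _ dc) (dchar_muln _ _ dc).
move/eqP; rewrite -{2}[S]mul1r -subr_eq0 -mulrBl mulf_eq0 subr_eq0 (negPf a1) /=.
by move/eqP.
Qed.

(** Full periods cancel, and fewer than [q] terms of norm at most 1 remain. *)
Lemma dchar_partial_sum (R : realType) (q N : nat) (chi : int -> R[i]) :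
  (0 < q)%N -> dirichlet_character q chi -> nonprincipal chi ->
  `|\sum_(0 <= n < N) chi n%:Z| <= q%:R.
Proof.
move=> q0 dc np.
have full k : \sum_(0 <= n < k * q) chi n%:Z = 0.
  elim: k => [|k IH]; first by rewrite mul0n big_geq.
  rewrite (@big_cat_nat _ _ _ (k * q)) ?leq_mul2r ?leqnSn ?orbT //= IH add0r.
  rewrite -{1}[(k * q)%N]add0n big_addn mulSn addnK -[RHS](dchar_sum0 q0 dc np).
  by apply: eq_bigr => n _; rewrite PoszD PoszM (dchar_perz _ _ dc).
rewrite (@big_cat_nat _ _ _ (N %/ q * q)) ?leq_trunc_div //= full add0r.
apply: (le_trans (ler_norm_sum _ _ _)).
apply: (@le_trans _ _ (\sum_(N %/ q * q <= i < N) 1)).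
  by apply: ler_sum => n _; rewrite (dchar_norm _ q0 dc) lern1 leq_b1.
rewrite big_const_nat iter_addr_0 ler_nat.
have := ltn_mod N q; rewrite q0 {2}(divn_eq N q); lia.
Qed.

(** The case [D = totient q], [K = 0], [M = #|U|] of [quasi_bessel]; the off-diagonal sums vanish by
    orthogonality. *)
Lemma card_dchar_le (R : realType) (q : nat) (s : seq (int -> R[i]))
    (U : {set 'I_q}) :
  (0 < q)%N -> uniq s -> {in s, forall chi, dirichlet_character q chi} ->
  {in s, forall chi : int -> R[i], {in U, forall n : 'I_q, chi (n : nat)%:Z = 1}} ->
  (size s * #|U| <= totient q)%N.
Proof.
move=> q0 us ds U1.
suff H : ((size s * #|U|) ^ 2 <=
    #|U| * (size s * totient q + size s ^ 2 * 0))%N.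
  have [->//|r0] := posnP (size s * #|U|)%N.
  rewrite -(leq_pmul2l r0) mulnn; apply: leq_trans H _.
  by rewrite muln0 addn0 mulnA [(#|U| * _)%N]mulnC.
apply: (@quasi_bessel R[i] _ s (fun chi n => chi n%:Z)) =>
  // [chi sc|chi psi sc sp neq|chi sc].
- rewrite (eq_bigr (fun n : 'I_q => (coprime n q)%:R)); last first.
    by move=> n _; rewrite (dchar_mul_conj _ q0 (ds _ sc)).
  rewrite -natr_sum ler_nat totient_count_coprime big_mkord.
  by apply: leq_sum => i _; rewrite coprime_sym.
- have [n cn neqn] : exists2 n, coprime n q & chi n%:Z != psi n%:Z.
    apply: contrapT => H; move/eqP: neq; apply.
    apply: (dchar_ext q0 (ds _ sc) (ds _ sp)) => n cn.
    by apply/eqP; apply: contrapT => /negP neqn; apply: H; exists n.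
  rewrite -[X in `|X|](big_mkord xpredT (fun n => chi n%:Z * (psi n%:Z)^*%R)).
  rewrite (@dchar_sum0 _ q (fun a => chi a * (psi a)^*%R)) ?normr0 //.
    apply: dchar_mul_conjc (ds _ sc) (ds _ sp) => // a; by rewrite andbb.
  exact: (dchar_mul_conjc_nonprincipal q0 (ds _ sc) (ds _ sp) cn cn neqn).
- by rewrite (eq_bigr (fun=> 1)) ?sumr_const // => n Un; apply: U1.
Qed.

(** These are the characters of the unit group of ['Z_q], extended by 0. *)
Lemma exists_dchars (R : realType) (q : nat) : (0 < q)%N ->
  exists2 s : seq (int -> R[i]), uniq s /\ size s = totient q &
    {in s, forall chi, dirichlet_character q chi}.
Proof.
(* Modulus 1 is separate because ['Z_1] has two elements. *)
case: q => // -[_|q' _].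
  exists [:: fun=> 1] => // chi; rewrite inE => /eqP ->; split => // [a b|a].
    by rewrite mulr1.
  by rewrite oner_eq0 coprimezE coprimen1.
set q := q'.+2; have q1 : (1 < q)%N by [].
pose G := [set: {unit 'Z_q}]%G.
have cG : #|G| = totient q by rewrite -card_units_Zp.
have aG : abelian G by exact: units_Zp_abelian.
have [f [f1 fM finj]] := abelian_characters R[i] aG.
(* On non-units [u] takes the default value 1, which [X] overrides by 0. *)
pose u (a : int) : {unit 'Z_q} := insubd (1%g : {unit 'Z_q}) (a%:~R : 'Z_q).
have uu a : coprimez a q%:Z -> (a%:~R : 'Z_q) \is a GRing.unit.
  rewrite coprimezE absz_nat; case: a => n /= cn;
    first by rewrite unitZpE // coprime_sym.
  by rewrite NegzE mulrNz unitrN unitZpE // coprime_sym.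
have valu a : coprimez a q%:Z -> val (u a) = a%:~R by move=> /uu h; rewrite insubdK.
pose X i (a : int) : R[i] := if coprimez a q%:Z then f i (u a) else 0.
have qz : (q%:Z%:~R : 'Z_q) = 0 by rewrite -[RHS](@pchar_Zp q).
have f0 i (x : {unit 'Z_q}) : f i x != 0.
  have := fM i x (x^-1)%g; rewrite !inE => /(_ isT isT).
  rewrite mulgV f1 => /eqP; apply: contraTneq => ->; rewrite mul0r;
    exact: oner_neq0.
have dX i : dirichlet_character q (X i).
  split => [a|a b|a]; rewrite /X.
  - have -> : coprimez (a + q%:Z) q%:Z = coprimez a q%:Z.
      by rewrite /coprimez gcdzC gcdzDr gcdzC.
    case: ifP => // ca; congr f; apply: val_inj; rewrite !valu //.
      by rewrite rmorphD /= qz addr0.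
    by rewrite /coprimez gcdzC gcdzDr gcdzC.
  - rewrite coprimezMl; case: (boolP (coprimez a _)) => ca /=;
      last by rewrite mul0r.
    case: (boolP (coprimez b _)) => cb /=; last by rewrite mulr0.
    rewrite -fM ?inE //; congr f; apply: val_inj.
    by rewrite FinRing.val_unitM !valu // ?rmorphM // coprimezMl ca.
  - by case: ifP => ca; rewrite ?f0 ?eqxx.
exists [seq X i | i <- enum 'I_#|G|].
  split; last by rewrite size_map size_enum_ord cG.
  rewrite map_inj_uniq ?enum_uniq // => i j eqX; apply: finj => x _.
  have cx : coprimez (val x : nat)%:Z q%:Z.
    by rewrite coprimezE !absz_nat coprime_sym -unitZpE // natr_Zp; exact: valP.
  have ux : u (val x : nat)%:Z = x.
    by apply: val_inj; rewrite valu // -[RHS]natr_Zp.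
  by have := congr1 (fun g => g (val x : nat)%:Z) eqX; rewrite /X cx ux.
by move=> _ /mapP[i _ ->].
Qed.

(** Every character is 1 at the residue of 1, so [card_dchar_le] allows at most [totient q] of them
    in any finite family. *)
Lemma finite_dchar (R : realType) (q : nat) : (0 < q)%N ->
  finite_set [set chi : int -> R[i] | dirichlet_character q chi].
Proof.
move=> q0; apply: contrapT => /(infinite_set_fset (totient q).+1)[B BD].
apply/negP; rewrite -leqNgt.
have U1 : 1%N = #|[set Ordinal (ltn_pmod 1 q0)]%SET| by rewrite cards1.
rewrite -[size B]muln1 [X in (_ * X)%N]U1; apply: card_dchar_le => //.
- exact: fset_uniq.
- move=> chi cB n; rewrite inE => /eqP -> /=.
  by rewrite (@dchar_modn _ q) ?(@dchar1 _ q) //; exact: (BD chi cB).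
Qed.

Definition dchars (R : realType) (q : nat) : {fset int -> R[i]} :=
  fset_set [set chi | dirichlet_character q chi].
Arguments dchars R q : clear implicits.

Lemma dcharsP (R : realType) (q : nat) (chi : int -> R[i]) : (0 < q)%N ->
  reflect (dirichlet_character q chi) (chi \in dchars R q).
Proof.
by move=> q0; rewrite in_fset_set ?inE; [exact: asboolP | exact: finite_dchar].
Qed.

Lemma size_dchars (R : realType) (q : nat) : (0 < q)%N ->
  size (dchars R q) = totient q.
Proof.
move=> q0; apply/eqP; rewrite eqn_leq; apply/andP; split.
  have U1 : 1%N = #|[set Ordinal (ltn_pmod 1 q0)]%SET| by rewrite cards1.
  rewrite -[size _]muln1 [X in (_ * X)%N]U1; apply: card_dchar_le => //.
  - exact: fset_uniq.
  - by move=> chi /(dcharsP _ q0).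
  - move=> chi /(dcharsP _ q0) dc n; rewrite inE => /eqP -> /=.
    by rewrite (dchar_modn _ dc) (dchar1 dc).
have [s [us <-] ds] := exists_dchars R q0.
by apply: uniq_leq_size => // chi /ds /(dcharsP _ q0).
Qed.

(** * Primitive characters *)

Lemma coprime_primeP (m n : nat) :
  (forall p, prime p -> p %| m -> p %| n -> False)%N -> coprime m n.
Proof.
move=> H; apply/negPn/negP => ncop.
have [g0|g0] := posnP (gcdn m n).
  move/eqP: g0; rewrite eqn0Ngt gcdn_gt0 negb_or -!eqn0Ngt =>
    /andP[/eqP m0 /eqP n0].
  by apply: (H 2) => //; rewrite ?m0 ?n0.
have g1 : (1 < gcdn m n)%N by move: ncop g0; rewrite /coprime; case: gcdn => [|[]].
apply: (H (pdiv (gcdn m n))); rewrite ?pdiv_prime //.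
  exact: dvdn_trans (pdiv_dvd _) (dvdn_gcdl _ _).
exact: dvdn_trans (pdiv_dvd _) (dvdn_gcdr _ _).
Qed.

(** Let [k] be the product of the primes of [q] that do not divide [a]. Each prime of [q] then
    divides exactly one of [a] and [k * d], hence not their sum. *)
Lemma coprime_lift (a d q : nat) : (0 < q)%N -> (d %| q)%N -> coprime a d ->
  exists k, coprime (a + k * d) q.
Proof.
move=> q0 dq cad; pose k := (\prod_(p <- primes q | ~~ (p %| a)) p)%N.
exists k; apply: coprime_primeP => p pp pakd pq.
have pk : (p %| k)%N = ~~ (p %| a)%N.
  have [pa|pa] := boolP (p %| a)%N.
    rewrite /k Euclid_dvd_prod // big_has_cond; apply/hasPn => r.
    rewrite mem_primes => /and3P[pr _ _]; apply/negP => /andP[ra].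
    by rewrite dvdn_prime2 // => /eqP pr'; rewrite -pr' pa in ra.
  rewrite /k (big_rem p) ?mem_primes ?pp ?q0 //= pa; exact: dvdn_mulr.
have [pa|pa] := boolP (p %| a)%N; last first.
  by move: pakd; rewrite dvdn_addl ?(negPf pa) // dvdn_mulr // pk.
move: pakd; rewrite dvdn_addr // Euclid_dvdM // pk pa /= => pd.
have : (p %| gcdn a d)%N by rewrite dvdn_gcd pa.
by rewrite (eqP cad) dvdn1 => /eqP p1; rewrite p1 in pp.
Qed.

Lemma coprimez_mod (a : int) (q : nat) :
  coprimez (a %% q%:Z)%Z q%:Z = coprimez a q%:Z.
Proof. by rewrite /coprimez gcdz_modl. Qed.

Lemma coprimez_eqmod (a b : int) (q : nat) :
  (a = b %[mod q%:Z])%Z -> coprimez a q%:Z = coprimez b q%:Z.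
Proof. by rewrite -(coprimez_mod a) -(coprimez_mod b) => ->. Qed.

Lemma eqmodz_addM (a k : int) (d : nat) : (a + k * d%:Z = a %[mod d%:Z])%Z.
Proof. by rewrite addrC modzMDl. Qed.

Lemma eqmodz_dvd (a b : int) (d q : nat) :
  (d %| q)%N -> (a = b %[mod q%:Z])%Z -> (a = b %[mod d%:Z])%Z.
Proof.
move=> dq /eqP; rewrite eqz_mod_dvd => h; apply/eqP; rewrite eqz_mod_dvd.
by apply: dvdz_trans h; rewrite dvdzE !absz_nat.
Qed.

Lemma coprimez_dvd (a : int) (d q : nat) :
  (d %| q)%N -> coprimez a q%:Z -> coprimez a d%:Z.
Proof. by rewrite !coprimezE !absz_nat; exact: coprime_dvdr. Qed.

Lemma coprimez_lift (a : int) (d q : nat) : (0 < q)%N -> (d %| q)%N ->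
  coprimez a d%:Z ->
  exists2 b : int, (b = a %[mod d%:Z])%Z & coprimez b q%:Z.
Proof.
move=> q0 dq; rewrite -coprimez_mod => cad.
have d0 : (0 < d)%N by apply: dvdn_gt0 dq.
have d0z : d%:Z != 0 by rewrite eqz_nat -lt0n.
have := modz_ge0 a d0z; case E : (a %% d%:Z)%Z cad => [n|//] cnd _.
have [k ck] : exists k, coprime (n + k * d) q.
  by apply: coprime_lift; move: cnd; rewrite ?coprimezE ?absz_nat.
exists (n + k * d)%N%:Z; last by rewrite coprimezE !absz_nat ck.
by rewrite PoszD PoszM eqmodz_addM -E modz_mod.
Qed.

(** A character that depends only on the residue modulo [d] descends to modulus [d]: evaluate it at
    a lift, coprime to [q], of each residue coprime to [d]. Primitivity then excludes [d < q]. *)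
Lemma primitive_modulus (R : realType) (q d : nat) (chi : int -> R[i]) :
  (0 < q)%N -> primitive q chi -> (d %| q)%N ->
  (forall a b, coprimez a q%:Z -> coprimez b q%:Z ->
    (a = b %[mod d%:Z])%Z -> chi a = chi b) -> d = q.
Proof.
move=> q0 [dc prim] dq fact; apply: contrapT => /eqP ndq.
have ltdq : (d < q)%N by rewrite ltn_neqAle ndq dvdn_leq.
apply: prim.
have /choice[l lP] : forall a : int, exists b, coprimez a d%:Z ->
    (b = a %[mod d%:Z])%Z /\ coprimez b q%:Z.
  move=> a; have [ca|] := boolP (coprimez a d%:Z); last by exists 0.
  by have [b ab cb] := coprimez_lift q0 dq ca; exists b.
exists d, (fun a => if coprimez a d%:Z then chi (l a) else 0); split => //.
- split => [a|a b|a].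
  + have eqa : (a + d%:Z = a %[mod d%:Z])%Z by rewrite modzDr.
    have ca : coprimez (a + d%:Z) d%:Z = coprimez a d%:Z by exact: coprimez_eqmod.
    rewrite ca; case: ifP => // cad.
    have [e1 c1] := lP _ cad; have [e2 c2] := lP (a + d%:Z) (etrans ca cad).
    by apply: fact => //; rewrite e1 e2.
  + rewrite coprimezMl; case: (boolP (coprimez a d%:Z)) => ca /=;
      last by rewrite mul0r.
    case: (boolP (coprimez b d%:Z)) => cb /=; last by rewrite mulr0.
    have [e1 c1] := lP _ ca; have [e2 c2] := lP _ cb.
    have [|e3 c3] := lP (a * b); first by rewrite coprimezMl ca.
    rewrite -(dchar_mulz _ _ dc); apply: fact => //; first by rewrite coprimezMl c1.
    by rewrite e3 -modzMml -modzMmr -e1 -e2 modzMml modzMmr.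
  + case: ifP => ca; last by rewrite eqxx.
    by have [_ c1] := lP _ ca; case: dc => _ _ ->.
- move=> a; case: ifP => ca; last by rewrite (dchar_eq0 dc) ?ca.
  rewrite (coprimez_dvd dq ca).
  by have [e1 c1] := lP _ (coprimez_dvd dq ca); apply: fact.
Qed.

(** It is shown that [chi1] depends only on the residue modulo [gcdn d1 d2], so that
    [primitive_modulus] gives [gcdn d1 d2 = d1]; by symmetry the gcd is also [d2]. If [a] and [b]
    agree modulo the gcd, some [t] is [a] modulo [d1] and [b] modulo [d2], and [chi1 a = chi1 t =
    chi2 t = chi2 b = chi1 b] after lifting to integers coprime to [q]. *)
Lemma primitive_unique (R : realType) (q d1 d2 : nat)
    (chi1 chi2 : int -> R[i]) :
  (0 < q)%N -> (d1 %| q)%N -> (d2 %| q)%N ->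
  primitive d1 chi1 -> primitive d2 chi2 ->
  (forall n : nat, coprime n q -> chi1 n%:Z = chi2 n%:Z) ->
  d1 = d2 /\ chi1 = chi2.
Proof.
wlog suff H : d1 d2 chi1 chi2 /
    (0 < q)%N -> (d1 %| q)%N -> (d2 %| q)%N ->
    primitive d1 chi1 -> primitive d2 chi2 ->
    (forall n : nat, coprime n q -> chi1 n%:Z = chi2 n%:Z) ->
    gcdn d1 d2 = d1.
  move=> q0 dq1 dq2 p1 p2 eq.
  have E : d1 = d2.
    rewrite -(H d1 d2 chi1 chi2) // gcdnC.
    by apply: (H d2 d1 chi2 chi1) => // n /eq ->.
  split=> //; subst d2; have d0 := dvdn_gt0 q0 dq1.
  apply: (dchar_ext d0 p1.1 p2.1) => n cn.
  have [k ck] := coprime_lift q0 dq1 cn.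
  have h (chi : int -> R[i]) : dirichlet_character d1 chi ->
      chi n%:Z = chi (n + k * d1)%N%:Z.
    by move=> dc; rewrite PoszD PoszM (dchar_perz _ _ dc).
  by rewrite (h _ p1.1) (h _ p2.1) eq.
move=> q0 dq1 dq2 p1 p2 eq.
have d10 := dvdn_gt0 q0 dq1; have d20 := dvdn_gt0 q0 dq2.
have eqz a : coprimez a q%:Z -> chi1 a = chi2 a.
  move=> ca.
  have q0z : q%:Z != 0 by rewrite eqz_nat -lt0n.
  have := modz_ge0 a q0z; case E : (a %% q%:Z)%Z => [n|//] _.
  have an : (a = n%:Z %[mod q%:Z])%Z by rewrite -E modz_mod.
  have e1 := dchar_eqmod p1.1 (eqmodz_dvd dq1 an).
  have e2 := dchar_eqmod p2.1 (eqmodz_dvd dq2 an).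
  by rewrite e1 e2 eq // -(absz_nat n) -(absz_nat q) -coprimezE -(coprimez_eqmod
    an).
apply: (primitive_modulus d10 p1 (dvdn_gcdl _ _)) => a b ca cb.
(* [b] is moved within its class modulo [d1] to be coprime to [q], where [chi1] and [chi2] agree. *)
have [b' b'b cb'] := coprimez_lift q0 dq1 cb.
move=> ab; have : (a = b' %[mod (gcdn d1 d2)%:Z])%Z.
  by rewrite ab; apply/esym/(eqmodz_dvd (dvdn_gcdl d1 d2)).
move=> /eqP; rewrite eqz_mod_dvd => /dvdzP[w abw].
have [u [v uv]] := Bezoutz d1%:Z d2%:Z.
have {uv} g_uv : (gcdn d1 d2)%:Z = u * d1%:Z + v * d2%:Z by rewrite uv.
(* Chinese remainders for moduli that need not be coprime: [t] is [a] modulo [d1] and [b'] modulo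
   [d2]. *)
pose t := b' + (w * v) * d2%:Z.
have ta : t = a + (- (w * u)) * d1%:Z.
  by rewrite /t -[a](subrK b') abw g_uv; ring.
have t1 : (t = a %[mod d1%:Z])%Z by rewrite ta eqmodz_addM.
have t2 : (t = b' %[mod d2%:Z])%Z by rewrite /t eqmodz_addM.
have dql : (lcmn d1 d2 %| q)%N by rewrite dvdn_lcm dq1.
have cl : coprimez t (lcmn d1 d2)%:Z.
  have : coprimez t (d1 * d2)%N%:Z.
    rewrite PoszM coprimezMr (coprimez_eqmod t1) ca (coprimez_eqmod t2).
    exact: coprimez_dvd cb'.
  by apply: coprimez_dvd; rewrite dvdn_lcm dvdn_mulr ?dvdn_mull.
have [t' t't ct'] := coprimez_lift q0 dql cl.
rewrite -(dchar_eqmod p1.1 (_ : t' = a %[mod d1%:Z])%Z); last first.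
  by rewrite -t1; apply: eqmodz_dvd t't; exact: dvdn_lcml.
rewrite eqz // (dchar_eqmod p2.1 (_ : t' = b' %[mod d2%:Z])%Z); last first.
  by rewrite -t2; apply: eqmodz_dvd t't; exact: dvdn_lcmr.
by rewrite -eqz // (dchar_eqmod p1.1 b'b).
Qed.

Lemma exists_conductor (R : realType) (q : nat) (chi : int -> R[i]) :
  (0 < q)%N -> dirichlet_character q chi ->
  exists d (psi : int -> R[i]),
    [/\ (d %| q)%N, primitive d psi & induced_by q chi psi].
Proof.
elim/ltn_ind: q chi => q IH chi q0 dc.
have [[d [psi [dq ltdq dp ind]]]|nind] := pselect (exists d (psi : int -> R[i]),
      [/\ (d %| q)%N, (d < q)%N, dirichlet_character d psi & induced_by q chi psi]).
  have [e [psi' [ed pe inde]]] := IH _ ltdq psi (dvdn_gt0 q0 dq) dp.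
  exists e, psi'; split => //; first exact: dvdn_trans dq.
  move=> a; rewrite ind; case: ifP => // ca.
  by rewrite inde (coprimez_dvd dq ca).
exists q, chi; split => // a; case: ifPn => // ca; exact: dchar_eq0 dc ca.
Qed.

Definition induced (R : realType) (q : nat) (psi : int -> R[i]) (a : int) : R[i] :=
  if coprimez a q%:Z then psi a else 0.

Lemma dchar_induced (R : realType) (q d : nat) (psi : int -> R[i]) :
  (d %| q)%N -> dirichlet_character d psi ->
  dirichlet_character q (induced q psi).
Proof.
move=> dq dp; split => [a|a b|a]; rewrite /induced.
- have eqa : (a + q%:Z = a %[mod q%:Z])%Z by rewrite modzDr.
  rewrite (coprimez_eqmod eqa) (dchar_eqmod dp (eqmodz_dvd dq eqa)).
  by [].
- rewrite coprimezMl; case: (boolP (coprimez a _)) => ca /=; last by rewrite mul0r.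
  case: (boolP (coprimez b _)) => cb /=; last by rewrite mulr0.
  exact: dchar_mulz dp.
- case: ifPn => ca; last by rewrite eqxx.
  by case: dp => _ _ ->; rewrite (coprimez_dvd dq ca).
Qed.

Definition primitives (R : realType) (q : nat) : seq (int -> R[i]) :=
  [seq chi <- dchars R q | `[< primitive q chi >]].
Arguments primitives R q : clear implicits.

Lemma primitivesP (R : realType) (q : nat) (chi : int -> R[i]) : (0 < q)%N ->
  reflect (primitive q chi) (chi \in primitives R q).
Proof.
move=> q0; rewrite mem_filter; apply: (iffP andP) => [[/asboolP //]|pc].
by split; [apply/asboolP|apply/(dcharsP _ q0); case: pc].
Qed.

(** Each character modulo [q] is induced by exactly one primitive character of modulus dividing
    [q]. *)
Lemma totient_sum_primitives (R : realType) (q : nat) : (0 < q)%N ->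
  totient q = (\sum_(d <- divisors q) size (primitives R d))%N.
Proof.
move=> q0; rewrite -(size_dchars R q0).
pose P := [seq (d, psi) | d <- divisors q, psi <- primitives R d].
have uP : uniq P.
  apply: allpairs_uniq_dep => [|d _|[d psi] [d' psi'] _ _ /= [-> ->] //].
    exact: divisors_uniq.
  by apply: filter_uniq; exact: fset_uniq.
have memP p : p \in P -> (p.1 %| q)%N /\ primitive p.1 p.2.
  move=> /allpairsPdep[d [psi [dq pp ->]]] /=.
  have dvq : (d %| q)%N by rewrite dvdn_divisors.
  by split=> //; apply/(primitivesP _ (dvdn_gt0 q0 dvq)).
suff /perm_size -> : perm_eq (dchars R q) [seq induced q p.2 | p <- P].
  by rewrite size_map size_allpairs_dep sumnE big_map.
apply: uniq_perm; first exact: fset_uniq.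
  rewrite map_inj_in_uniq // =>
    -[d psi] [d' psi'] /memP[/= dq pp] /memP[/= dq' pp'] eqi.
  have [|-> -> //] := primitive_unique q0 dq dq' pp pp'.
  move=> n cn; have := congr1 (fun g => g n%:Z) eqi.
  by rewrite /induced coprimezE !absz_nat cn.
move=> chi; apply/(dcharsP _ q0)/mapP => [dc|[[d psi] /memP[/= dq pp] ->]];
  last first.
  exact: dchar_induced dq pp.1.
have [d [psi [dq pp ind]]] := exists_conductor q0 dc.
exists (d, psi); last by apply/funext => a; rewrite ind.
apply/allpairsPdep; exists d, psi; split => //; first by rewrite -dvdn_divisors.
by apply/(primitivesP _ (dvdn_gt0 q0 dq)).
Qed.

(** * Characters that are trivial on small integers *)

(** For nonprincipal characters this is [z < least_nonresidue chi], in a form that passes to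
    products of small integers. *)
Definition trivial_upto (R : realType) (z : nat) (chi : int -> R[i]) :=
  forall n : nat, (0 < n <= z)%N -> chi n%:Z = 0 \/ chi n%:Z = 1.

(** Indexing by exponent vectors makes distinctness a matter of unique factorization. The vectors
    have entries below [e] in [card_trivial_small] and entries 0 or 1 in [large_sieve_trivial]. *)
Definition prime_prod (s : seq nat) (f : 'I_(size s) -> nat) : nat :=
  (\prod_(i < size s) (nth 0%N s i) ^ f i)%N.

Lemma logn_prod (I : Type) (r : seq I) (P : pred I) (g : I -> nat) (p : nat) :
  (forall i, 0 < g i)%N ->
  logn p (\prod_(i <- r | P i) g i) = (\sum_(i <- r | P i) logn p (g i))%N.
Proof.
move=> g0.
suff [] : logn p (\prod_(i <- r | P i) g i) =
  (\sum_(i <- r | P i) logn p (g i))%N /\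
  (0 < \prod_(i <- r | P i) g i)%N by [].
elim/big_rec2: _ => [|i m1 m2 _ [IH m20]]; first by rewrite logn1.
by rewrite lognM // IH muln_gt0 g0.
Qed.

Lemma logn_prime_prod (s : seq nat) (f : 'I_(size s) -> nat) (j : 'I_(size s)) :
  uniq s -> all prime s -> logn (nth 0%N s j) (prime_prod f) = f j.
Proof.
move=> us /allP ps.
have pr (i : 'I_(size s)) : prime (nth 0%N s i) by apply/ps/mem_nth.
rewrite /prime_prod logn_prod => [|i]; last by rewrite expn_gt0 prime_gt0.
rewrite (bigD1 j) //= big1 ?addn0 => [|i ij].
  by rewrite lognX logn_prime ?pr // eqxx muln1.
by rewrite lognX logn_prime ?pr // nth_uniq // eq_sym val_eqE (negPf ij) muln0.
Qed.

Lemma prime_prod_inj (s : seq nat) (f g : 'I_(size s) -> nat) :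
  uniq s -> all prime s -> prime_prod f = prime_prod g -> f =1 g.
Proof. by move=> us ps e j;
  rewrite -(logn_prime_prod f j us ps) e logn_prime_prod. Qed.

Lemma trivial_upto_prime (R : realType) (q z p : nat) (chi : int -> R[i]) :
  dirichlet_character q chi -> trivial_upto z chi -> prime p -> (p <= z)%N ->
  ~~ (p %| q)%N -> chi p%:Z = 1.
Proof.
move=> dc tz pp pz npq; have [] // := tz p; first by rewrite prime_gt0.
by move/eqP; rewrite -[_ == 0]negbK (dchar_neq0 _ dc) prime_coprime // npq.
Qed.

Lemma dchar_prime_prod (R : realType) (q z : nat) (chi : int -> R[i])
    (s : seq nat) (f : 'I_(size s) -> nat) :
  dirichlet_character q chi -> trivial_upto z chi -> all prime s ->
  {in s, forall p, (p <= z)%N && ~~ (p %| q)%N} ->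
  chi (prime_prod f)%:Z = 1.
Proof.
move=> dc tz /allP ps hs; rewrite /prime_prod.
elim/big_rec: _ => [|i m _ IH]; first exact: dchar1 dc.
rewrite (dchar_muln _ _ dc) IH mulr1 (dcharX _ _ dc).
have si : (nth 0%N s i) \in s by exact: mem_nth.
have /andP[pz npq] := hs _ si.
by rewrite (trivial_upto_prime dc tz (ps _ si) pz npq) expr1n.
Qed.

Lemma trivial_upto_smooth (R : realType) (q z m : nat) (chi : int -> R[i]) :
  dirichlet_character q chi -> trivial_upto z chi -> (0 < m)%N ->
  (forall p, prime p -> (p %| m)%N -> (p <= z)%N) ->
  chi m%:Z = 0 \/ chi m%:Z = 1.
Proof.
move=> dc tz; elim/ltn_ind: m => m IH m0 sm.
have [m1|m1] := leqP m 1.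
  have -> : m = 1%N by lia.
  by right; exact: dchar1 dc.
have pp := pdiv_prime m1; have pm := pdiv_dvd m.
rewrite -(divnK pm) (dchar_muln _ _ dc).
have [] := tz (pdiv m); rewrite ?prime_gt0 ?sm // => ->; first by left;
  rewrite mulr0.
rewrite mulr1; apply: IH.
- by rewrite ltn_Pdiv // prime_gt1.
- by rewrite divn_gt0 ?prime_gt0 // dvdn_leq.
- by move=> p p1 p2; apply: sm => //; apply: dvdn_trans p2 (dvdn_div pm).
Qed.

(** The products of primes of [s] with exponents below [e] are [e ^ size s] distinct integers below
    [z ^ (e * size s) <= q], and every [chi] is 1 at each of them; [card_dchar_le] applies. *)
Lemma card_trivial_small (R : realType) (q z e : nat) (s : seq nat)
    (S : seq (int -> R[i])) :
  (0 < q)%N -> uniq s -> all prime s -> (0 < size s)%N ->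
  {in s, forall p, (p <= z)%N && ~~ (p %| q)%N} ->
  (z ^ (e * size s) <= q)%N -> uniq S ->
  {in S, forall chi, dirichlet_character q chi /\ trivial_upto z chi} ->
  (size S * e ^ size s <= totient q)%N.
Proof.
move=> q0 us ps s0 hs ze uS hS.
have z1 : (1 < z)%N.
  have s00 : (nth 0%N s 0) \in s by exact: mem_nth.
  have /andP[pz _] := hs _ s00.
  by apply: leq_trans pz; apply/prime_gt1/(allP ps).
pose F (f : {ffun 'I_(size s) -> 'I_e}) : nat :=
  prime_prod (fun i => f i : nat).
have Flt f : (F f < q)%N.
  have e0 : (0 < e)%N by apply: leq_ltn_trans (ltn_ord (f (Ordinal s0))).
  apply: leq_trans ze; apply: (@leq_ltn_trans (z ^ (e.-1 * size s))); last first.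
    by rewrite ltn_exp2l // ltn_mul2r s0 /= ltn_predL.
  rewrite expnM -[X in (_ ^ X)%N]card_ord -prod_nat_const.
  apply: leq_prod => i _; have /andP[pz _] := hs _ (mem_nth 0%N (ltn_ord i)).
  apply: (@leq_trans (z ^ f i)); first by have [->|f0] := posnP (f i : nat);
    rewrite ?expn0 ?leq_exp2r //.
  by rewrite leq_exp2l // -ltnS prednK.
pose U := [set Ordinal (ltn_pmod (F f) q0) | f in {: {ffun 'I_(size s) ->
  'I_e}}]%SET.
have cU : #|U| = (e ^ size s)%N.
  rewrite card_imset ?card_ffun ?card_ord // => f g /(congr1 val) /=.
  rewrite !modn_small // => /(prime_prod_inj us ps) fg.
  by apply/ffunP => i; apply: val_inj; exact: fg.
rewrite -cU; apply: card_dchar_le =>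
  // [chi /hS[] //|chi /hS[dc tz] _ /imsetP[f _ ->]].
by rewrite /= (dchar_modn _ dc) (dchar_prime_prod _ dc tz ps hs).
Qed.

(** This is [quasi_bessel] on the integers up to [z ^ j]. For two distinct characters,
    [chi1 * conj chi2] is nonprincipal modulo [q1 * q2 <= n ^ 2], so its partial sums are at most
    [n ^ 2]. The ['C(k, j)] products of [j] primes of [s] give each character that many values 1. *)
Lemma large_sieve_trivial (R : realType) (n z j k : nat)
    (X : seq (nat * (int -> R[i]))) :
  uniq X ->
  {in X, forall x, [/\ (0 < x.1 <= n)%N, primitive x.1 x.2, trivial_upto z x.2 &
     exists s, [/\ size s = k, uniq s, all prime s &
       {in s, forall p, (p <= z)%N && ~~ (p %| x.1)%N}]]} ->
  ((size X * 'C(k, j)) ^ 2 <=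
    (z ^ j).+1 * (size X * (z ^ j).+1 + size X ^ 2 * n ^ 2))%N.
Proof.
move=> uX hX; set N := (z ^ j).+1.
(* The primes [s] vary with the conductor, but [U] must not. It consists of all [z]-smooth integers,
   where the characters are 0 or 1, so that integers outside the chosen products do no harm. *)
pose U := [set m : 'I_N | (0 < m)%N && all (fun p => p <= z)%N (primes m)]%SET.
apply: (@leq_trans (#|U| * (size X * N + size X ^ 2 * n ^ 2))%N); last first.
  by rewrite leq_mul2r -[X in (_ <= X)%N]card_ord max_card orbT.
apply: (@quasi_bessel R[i] _ X (fun x m => x.2 m%:Z)) => //.
- move=> [q chi] /hX[/= /andP[q0 _] [dc _] _ _].
  rewrite (eq_bigr (fun n : 'I_N => (coprime n q)%:R)); last first.
    by move=> m _; rewrite (dchar_mul_conj _ q0 dc).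
  rewrite -natr_sum ler_nat -[X in (_ <= X)%N]card_ord -sum1_card.
  by apply: leq_sum => m _; exact: leq_b1.
- move=> [q1 chi1] [q2 chi2] /hX[/= /andP[q10 q1n] p1 _ _] /hX[/= /andP[q20 q2n] p2
    _ _] neq.
  (* Two primitive characters that agree on the integers coprime to [q1 * q2] coincide, together
     with their moduli. *)
  have [m cm neqm] : exists2 m, coprime m (q1 * q2) & chi1 m%:Z != chi2 m%:Z.
    apply: contrapT => H; move/eqP: neq; apply.
    have q12 : (0 < q1 * q2)%N by rewrite muln_gt0 q10.
    have H2 m : coprime m (q1 * q2) -> chi1 m%:Z = chi2 m%:Z.
      by move=> cm; apply/eqP; apply: contrapT => /negP neqm; apply: H; exists m.
    by have [-> ->] := primitive_unique q12 (dvdn_mulr _ (dvdnn q1))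
      (dvdn_mull _ (dvdnn q2)) p1 p2 H2.
  have q0 : (0 < q1 * q2)%N by rewrite muln_gt0 q10.
  rewrite -[X in `|X|](big_mkord xpredT (fun n => chi1 n%:Z * (chi2 n%:Z)^*%R)).
  move: cm; rewrite coprimeMr => /andP[cm1 cm2].
  have np := dchar_mul_conjc_nonprincipal q20 p1.1 p2.1 cm1 cm2 neqm.
  have dm : dirichlet_character (q1 * q2) (fun a => chi1 a * (chi2 a)^*%R).
    apply: dchar_mul_conjc p1.1 p2.1; first exact: dvdn_mulr (dvdnn q1).
      exact: dvdn_mull (dvdnn q2).
    by move=> a; rewrite PoszM coprimezMr.
  apply: (le_trans (dchar_partial_sum N q0 dm np)).
  by rewrite ler_nat -mulnn leq_mul.
- move=> [q chi] /hX[/= /andP[q0 _] [dc _] tz [s [sk us ps hs]]].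
  pose T := [set A : {set 'I_(size s)} | #|A| == j]%SET.
  pose F (A : {set 'I_(size s)}) : nat := prime_prod (fun i => i \in A : nat).
  have FE A : F A = (\prod_(i in A) (nth 0%N s i))%N.
    by rewrite /F /prime_prod [RHS]big_mkcond; apply: eq_bigr => i _;
      case: (i \in A).
  have Flt A : A \in T -> (F A < N)%N.
    rewrite inE => /eqP cA; rewrite ltnS FE -cA -prod_nat_const.
    apply: leq_prod => i _; by case/andP: (hs _ (mem_nth 0%N (ltn_ord i))).
  have F0 A : (0 < F A)%N.
    by rewrite FE prodn_cond_gt0 // => i _; apply/prime_gt0/(allP ps)/mem_nth.
  pose V := [set (inord (F A) : 'I_N) | A in T]%SET.
  have cV : #|V| = 'C(k, j).
    rewrite card_in_imset ?card_draws ?card_ord ?sk // =>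
      A B AT BT /(congr1 val) /=.
    rewrite !inordK ?Flt // => /(prime_prod_inj us ps) AB.
    by apply/setP => i; have := AB i; do 2 case: (i \in _).
  have VU : V \subset U.
    apply/fintype.subsetP => _ /imsetP[A AT ->]; rewrite inE inordK ?Flt // F0 /=.
    apply/allP => p; rewrite mem_primes => /and3P[pp _];
      rewrite FE Euclid_dvd_prod //.
    rewrite big_orE => /existsP[i /andP[iA]].
    have ii := mem_nth 0%N (ltn_ord i).
    by have pi := allP ps _ ii; rewrite dvdn_prime2 // => /eqP ->;
      case/andP: (hs _ ii).
  have chiV m : m \in V -> chi (m : nat)%:Z = 1.
    move=> /imsetP[A AT ->]; rewrite inordK ?Flt //.
    exact: (dchar_prime_prod _ dc tz ps hs).
  rewrite (big_setID V) /= (finset.setIidPr VU) (eq_bigr (fun=> 1)) //.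
  rewrite sumr_const cV lerDl; apply: sumr_ge0 => m;
    rewrite !inE => /and3P[_ m0 /allP sm].
  have [|->|->] := trivial_upto_smooth dc tz m0; rewrite ?ler01 //.
  by move=> p pp pm; apply: sm; rewrite mem_primes pp m0.
Qed.

(** * Counting characters by least nonresidue *)

Definition nonprincipal_primitives (R : realType) (q : nat) : {fset int -> R[i]} :=
  fset_set (primitive_characters R q).
Arguments nonprincipal_primitives R q : clear implicits.

Lemma nonprincipal_primitivesP (R : realType) (q : nat) (chi : int -> R[i]) : (0 <
  q)%N ->
  reflect (primitive q chi /\
    nonprincipal chi) (chi \in nonprincipal_primitives R q).
Proof.
move=> q0; rewrite in_fset_set; last exact: finite_primitive_characters.
exact: asboolP.
Qed.

Lemma least_nonresidueP (R : realType) (q : nat) (chi : int -> R[i]) :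
  (0 < q)%N -> dirichlet_character q chi -> nonprincipal chi ->
  (least_nonresidue chi <= q)%N /\
  forall z, (z < least_nonresidue chi)%N <-> trivial_upto z chi.
Proof.
move=> q0 dc [a0 [a00 a01]].
have [m /andP[m0 mq] [mn0 mn1]] : exists2 m, (0 < m <= q)%N &
    chi m%:Z != 0 /\ chi m%:Z != 1.
  have [m mq E] := dchar_absz a0 q0 dc; rewrite E in a00 a01.
  (* The residue 0 is not positive and is replaced by [q]. *)
  have [m0|m0] := posnP m; last by exists m => //; rewrite m0 (ltnW mq).
  by exists q; rewrite ?q0 ?leqnn //= -(dchar_modn _ dc) modnn -m0.
rewrite /least_nonresidue; case: pselect => [exn|]; last first.
  by case; exists m; rewrite m0 mn0 mn1.
case: ex_minnP => l /and3P[l0 ln0 ln1] minl; split.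
  by apply: leq_trans mq; apply: minl; rewrite m0 mn0 mn1.
move=> z; split => [zl n /andP[n0 nz]|tz].
  have [/eqP|n_0] := boolP (chi n%:Z == 0); first by left.
  have [/eqP|n_1] := boolP (chi n%:Z == 1); first by right.
  have := minl n; rewrite n0 n_0 n_1 => /(_ isT); lia.
rewrite ltnNge; apply/negP => lz.
have [|/eqP|/eqP] := tz l; first by rewrite l0.
  by rewrite (negPf ln0).
by rewrite (negPf ln1).
Qed.

Definition count_gt (R : realType) (q z : nat) : nat :=
  count (fun chi => z < least_nonresidue chi)%N (nonprincipal_primitives R q).
Arguments count_gt R q z : clear implicits.

(** This is the quantity [F z x] of the overview, at [x = n]. *)
Definition total_gt (R : realType) (z n : nat) : nat :=
  (\sum_(1 <= q < n.+1) count_gt R q z)%N.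
Arguments total_gt R z n : clear implicits.

Lemma count_gt_mul_le (R : realType) (q z e : nat) (s : seq nat) :
  (0 < q)%N -> uniq s -> all prime s -> (0 < size s)%N ->
  {in s, forall p, (p <= z)%N && ~~ (p %| q)%N} ->
  (z ^ (e * size s) <= q)%N -> (count_gt R q z * e ^ size s <= totient q)%N.
Proof.
move=> q0 us ps s0 hs ze; rewrite /count_gt -size_filter.
apply: card_trivial_small ze _ _ => //; first exact/filter_uniq/fset_uniq.
move=> chi; rewrite mem_filter => /andP[zl /(nonprincipal_primitivesP _ q0)[pc nc]].
by split; [exact: pc.1|exact/(least_nonresidueP q0 pc.1 nc).2].
Qed.

Lemma totient_leq (q : nat) : (totient q <= q)%N.
Proof.
rewrite totient_count_coprime -[leqRHS]subn0 -[leqRHS]muln1 -sum_nat_const_nat.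
by apply: leq_sum => i _; exact: leq_b1.
Qed.

Lemma count_gt_le (R : realType) (q z : nat) : (0 < q)%N -> (count_gt R q z <= q)%N.
Proof.
move=> q0; apply: leq_trans (totient_leq q);
  rewrite -(size_dchars R q0) /count_gt -size_filter.
apply: uniq_leq_size; first exact/filter_uniq/fset_uniq.
move=> chi; rewrite mem_filter => /andP[_ /(nonprincipal_primitivesP _ q0)[pc _]].
exact/(dcharsP _ q0)/pc.1.
Qed.

(** Since [n_chi <= q <= n], the indicators of [z < n_chi] can be summed over the range [z < n],
    common to all moduli. *)
Lemma sum_least_nonresidue (R : realType) (q n : nat) : (0 < q <= n)%N ->
  \sum_(chi \in primitive_characters R q) ((least_nonresidue chi)%:R : R) =
  \sum_(0 <= z < n) (count_gt R q z)%:R.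
Proof.
move=> /andP[q0 qn]; have fin := finite_primitive_characters R q0.
rewrite fsbig_finite //= -/(nonprincipal_primitives R q) /count_gt.
under [RHS]eq_bigr => z _ do rewrite -sum1_count natr_sum big_mkcond /=.
rewrite exchange_big /= big_seq [RHS]big_seq;
  apply: eq_bigr => chi /(nonprincipal_primitivesP _ q0)[pc nc].
have ln := (least_nonresidueP q0 pc.1 nc).1.
rewrite (@big_cat_nat _ _ _ (least_nonresidue chi)) //=; last exact: leq_trans qn.
rewrite [X in _ = _ + X]big_nat_cond [X in _ = _ + X]big1 ?addr0; last first.
  by move=> z /andP[/andP[z1 _] _]; rewrite ltnNge z1.
rewrite big_nat_cond (eq_bigr (fun=> 1)); last by move=> z /andP[/andP[_ ->]].
by rewrite -big_nat_cond big_const_nat iter_addr_0 subn0.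
Qed.

Lemma count_primitive (R : realType) (q : nat) : (0 < q)%N ->
  \sum_(chi \in primitive_characters R q) (1 : R) = (count_gt R q 0)%:R.
Proof.
move=> q0; have fin := finite_primitive_characters R q0.
rewrite fsbig_finite //= -/(nonprincipal_primitives R q) /count_gt -sum1_count
  natr_sum [RHS]big_mkcond /=.
rewrite big_seq [RHS]big_seq;
  apply: eq_bigr => chi /(nonprincipal_primitivesP _ q0)[pc nc].
suff -> : (0 < least_nonresidue chi)%N by [].
by apply/(least_nonresidueP q0 pc.1 nc).2 => k;
  rewrite leqn0 => /andP[/lt0n_neq0/negPf ->].
Qed.

Lemma prod_primes_dvd (s : seq nat) (q : nat) : uniq s -> all prime s ->
  {in s, forall p, (p %| q)%N} -> (\prod_(p <- s) p %| q)%N.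
Proof.
elim: s => [_ _ _|p s IH /= /andP[ps us] /andP[pp pr] dq];
  first by rewrite big_nil dvd1n.
rewrite big_cons Gauss_dvd; last first.
  rewrite prime_coprime // Euclid_dvd_prod // big_has; apply/hasPn => r rs.
  rewrite dvdn_prime2 ?(allP pr _ rs) //; apply: contraNneq ps => ->; exact: rs.
rewrite dq ?mem_head // IH // => r rs; apply: dq; by rewrite inE rs orbT.
Qed.

(** A [q] divisible by four of the primes is a multiple of their product, which is at least [z ^ 2];
    each of the ['C(size S, 4)] products has at most [n / z ^ 2] multiples up to [n]. *)
Lemma card_many_divisors (S : seq nat) (z n : nat) : uniq S ->
  {in S, forall p, [/\ prime p, p <= z & z < p * p]%N} ->
  ((\sum_(1 <= q < n.+1) (3 < count (fun p => p %| q)%N S)) * z ^ 2 <=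
    'C(size S, 4) * n)%N.
Proof.
move=> uS hS; pose T := [set A : {set 'I_(size S)} | #|A| == 4]%SET.
pose P (A : {set 'I_(size S)}) := (\prod_(i in A) nth 0%N S i)%N.
have hi (i : 'I_(size S)) := hS _ (mem_nth 0%N (ltn_ord i)).
have zP A : A \in T -> (z ^ 2 <= P A)%N.
  rewrite inE => /eqP cA; rewrite -(@leq_exp2r _ _ 2) // -expnM.
  rewrite -[(2 * 2)%N]cA -prod_nat_const -mulnn /P -big_split /=.
  by apply: leq_prod => i _; case: (hi i) => _ _ /ltnW.
have P0 A : (0 < P A)%N by rewrite prodn_cond_gt0 // => i _;
  case: (hi i) => /prime_gt0.
have bad q : ((3 < count (fun p => p %| q)%N S) <= \sum_(A in T) (P A %| q))%N.
  have [c4|//] := boolP (3 < _)%N.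
  pose B := [set i : 'I_(size S) | (nth 0%N S i %| q)%N]%SET.
  have cB : (3 < #|B|)%N.
    apply: leq_trans c4 _; rewrite -sum1_count (big_nth 0%N) big_mkord -sum1_card.
    by rewrite eq_leq //; apply: eq_bigl => i; rewrite inE.
  have : (0 < #|[set A : {set 'I_(size S)} | A \subset B & #|A| == 4]%SET|)%N.
    by rewrite cards_draws bin_gt0.
  case/card_gt0P => A; rewrite inE => /andP[AB cA].
  rewrite (bigD1 A) /=; last by rewrite inE.
  suff -> : (P A %| q)%N by [].
  have -> : P A = (\prod_(p <- [seq nth 0%N S (i : 'I_(size S)) | i <- enum A])
    p)%N.
    by rewrite big_map big_enum.
  apply: prod_primes_dvd.
  - rewrite map_inj_uniq ?enum_uniq // => i i' /eqP; rewrite nth_uniq // => /eqP.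
    exact: val_inj.
  - by apply/allP => _ /mapP[i _ ->]; case: (hi i).
  - move=> _ /mapP[i iA ->]; rewrite mem_enum in iA.
    by have := fintype.subsetP AB _ iA; rewrite inE.
apply: (@leq_trans ((\sum_(A in T) n %/ P A) * z ^ 2))%N.
  rewrite leq_mul2r; apply/orP; right.
  apply: (@leq_trans (\sum_(1 <= q < n.+1) \sum_(A in T) (P A %| q)))%N.
    by apply: leq_sum => q _; exact: bad.
  rewrite exchange_big /=; apply: leq_sum => A _.
  rewrite (eq_bigr (fun q => if (P A %| q)%N then 1%N else 0%N)); last first.
    by move=> q _; case: (_ %| _)%N.
  rewrite -big_mkcond (sum_multiples (fun=> 1%N)) // sum_nat_const_nat.
  by rewrite subn1 muln1.
rewrite big_distrl /=; apply: (@leq_trans (\sum_(A in T) n))%N.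
  apply: leq_sum => A AT; apply: leq_trans (leq_trunc_div n (P A)).
  by rewrite leq_mul2l zP // orbT.
by rewrite sum_nat_const card_draws card_ord.
Qed.

Lemma sum_small_le (q0 n : nat) :
  (\sum_(1 <= q < n.+1) (q < q0) <= q0)%N.
Proof.
have [nq|qn] := leqP n.+1 q0.
  apply: (@leq_trans (\sum_(1 <= i < n.+1) 1)%N).
    by apply: leq_sum => i _; exact: leq_b1.
  by rewrite sum_nat_const_nat muln1 subn1 /= ltnW.
have [->|q00] := posnP q0; first by rewrite big1.
rewrite (@big_cat_nat _ _ _ q0) //=; last exact: ltnW.
rewrite [X in (_ + X)%N]big_nat_cond [X in (_ + X)%N]big1 ?addn0; last first.
  by move=> i /andP[/andP[qi _] _]; rewrite ltnNge qi.
apply: (@leq_trans (\sum_(1 <= i < q0) 1)%N).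
  by apply: leq_sum => i _; exact: leq_b1.
by rewrite sum_nat_const_nat muln1 leq_subr.
Qed.

(** The three terms come from three kinds of moduli: those below [q0]; those coprime to [k] of the
    [k + 3] primes, where [count_gt_mul_le] saves a factor [e ^ k]; and those divisible by at least
    four of the primes, which are rare. The first and the last are bounded trivially. *)
Lemma total_gt_small_range (R : realType) (S : seq nat) (z n e k q0 : nat) :
  uniq S -> {in S, forall p, [/\ prime p, p <= z & z < p * p]%N} ->
  size S = (k + 3)%N -> (0 < k)%N -> (0 < e)%N -> (0 < z)%N -> (z ^ (e * k) <=
    q0)%N ->
  (total_gt R z n)%:R <= q0%:R ^+ 2 + n%:R ^+ 2 / e%:R ^+ k +
    'C(size S, 4)%:R * n%:R ^+ 2 / z%:R ^+ 2 :> R.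
Proof.
move=> uS hS sS k0 e0 z0 zq0.
pose bad q := (3 < count (fun p => p %| q)%N S)%N.
have ek0 : 0 < e%:R ^+ k :> R by rewrite exprn_gt0 // ltr0n.
have b1 q : (1 <= q < n.+1)%N -> (count_gt R q z)%:R <=
    (q < q0)%:R * q0%:R + n%:R / e%:R ^+ k + (bad q)%:R * n%:R :> R.
  move=> /andP[q1 qn].
  have c0 : (count_gt R q z)%:R <= q%:R :> R by rewrite ler_nat count_gt_le.
  have [qq|qq] := ltnP q q0.
    rewrite mul1r -addrA; apply: (le_trans c0); apply: ler_wpDr.
      by apply: addr_ge0; [apply: divr_ge0 => //; exact: ltW | exact: mulr_ge0].
    by rewrite ler_nat ltnW.
  rewrite mul0r add0r; have [bq|nbq] := boolP (bad q).
    rewrite mul1r; apply: (le_trans c0); apply: ler_wpDl; last by rewrite ler_nat.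
    by apply: divr_ge0 => //; exact: ltW.
  rewrite mul0r addr0 ler_pdivlMr // -natrX -natrM ler_nat.
  apply: (@leq_trans (totient q)); last by apply: leq_trans (totient_leq q) _.
  pose s := take k [seq p <- S | ~~ (p %| q)%N].
  have ss : size s = k.
    rewrite size_takel // size_filter; move: nbq; rewrite /bad -leqNgt.
    have : size S = (count (fun p => p %| q)%N S + count (fun p =>
      ~~ (p %| q)%N) S)%N.
      by rewrite -(count_predC (fun p => p %| q)%N S).
    by rewrite sS; move: (count _ _) (count _ _) => u v; lia.
  have sP p : p \in s -> [/\ prime p, (p <= z)%N & ~~ (p %| q)%N].
    by move=> /mem_take; rewrite mem_filter => /andP[-> /hS[]].
  rewrite -{1}ss; apply: count_gt_mul_le => //.
  - exact/take_uniq/filter_uniq.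
  - by apply/allP => p /sP[].
  - by rewrite ss.
  - by move=> p /sP[_ -> ->].
  - by rewrite ss; apply: leq_trans qq.
rewrite /total_gt natr_sum big_nat; apply: (le_trans (ler_sum _ b1)).
rewrite -big_nat !big_split /=; apply: lerD; first apply: lerD.
- by rewrite -mulr_suml expr2 ler_wpM2r // -natr_sum ler_nat sum_small_le.
- by rewrite big_const_nat iter_addr_0 subn1 /= -[leLHS]mulr_natr mulrAC -expr2.
- rewrite -mulr_suml -natr_sum expr2 mulrA mulrAC ler_wpM2r //.
  rewrite ler_pdivlMr ?exprn_gt0 ?ltr0n // -natrX -!natrM ler_nat.
  exact: card_many_divisors.
Qed.

(** * Characters with a large least nonresidue *)

Lemma primitive_nonprincipal (R : realType) (q : nat) (chi : int -> R[i]) :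
  (1 < q)%N -> primitive q chi -> nonprincipal chi.
Proof.
move=> q1 [dc prim]; apply: contrapT => np; apply: prim.
exists 1%N, (fun=> 1); split; rewrite ?dvd1n //.
  split => // [a b|a]; first by rewrite mulr1.
  by rewrite oner_eq0 coprimezE coprimen1.
move=> a; case: ifPn => ca; last exact: dchar_eq0 dc ca.
apply/eqP; apply: contrapT => /negP a1; apply: np; exists a; split => //.
by case: dc => _ _ ->.
Qed.

Lemma trivial_upto_multiple (R : realType) (q z : nat) (chi : int -> R[i]) :
  dirichlet_character q chi -> multiple_of_all (primes_upto z) q ->
  trivial_upto z chi.
Proof.
move=> dc /allP mq n /andP[n0 nz].
have [n1|n1] := leqP n 1.
  by right; rewrite (_ : n = 1%N) ?(dchar1 dc) //; lia.
have pq : (pdiv n %| q)%N.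
  by apply: mq; rewrite mem_primes_upto pdiv_prime // (leq_trans _ nz) // dvdn_leq
    // pdiv_dvd.
left; apply: (dchar_eq0 dc); rewrite coprimezE !absz_nat; apply/negP => /eqP g1.
have : (pdiv n %| gcdn n q)%N by rewrite dvdn_gcd pdiv_dvd.
by rewrite g1 dvdn1 => /eqP p1; have := pdiv_prime n1; rewrite p1.
Qed.

Lemma count_gt_multiple (R : realType) (q z : nat) : (1 < q)%N ->
  multiple_of_all (primes_upto z) q -> count_gt R q z = size (primitives R q).
Proof.
move=> q1 mq; have q0 := ltnW q1; rewrite /count_gt -size_filter; apply: perm_size.
apply: uniq_perm; rewrite ?filter_uniq ?fset_uniq // => chi.
rewrite mem_filter; apply/andP/(primitivesP _ q0) =>
  [[_ /(nonprincipal_primitivesP _ q0)[]] //|pc].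
have nc := primitive_nonprincipal q1 pc; split;
  last exact/(nonprincipal_primitivesP _ q0).
by apply/(least_nonresidueP q0 pc.1 nc).2; exact: trivial_upto_multiple pc.1 mq.
Qed.

Lemma size_primitives_le (R : realType) (q : nat) : (0 < q)%N ->
  (size (primitives R q) <= q)%N.
Proof.
move=> q0; apply: leq_trans (totient_leq q); rewrite -(size_dchars R q0).
by rewrite size_filter count_size.
Qed.

(** If some prime [p <= z] does not divide [q], then [chi] is 1 at [e] powers of [p], distinct
    modulo [q] since [z ^ e <= q], which leaves at most [n / e] characters. The threshold
    [(z ^ e).+2] also ensures [1 < q]. *)
Lemma count_gt_multiple_approx (R : realType) (q z e n : nat) :
  (0 < q <= n)%N -> (0 < e)%N ->
  `|(count_gt R q z)%:R - (if multiple_of_all (primes_upto z) q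
     then (size (primitives R q))%:R else 0)| <=
  (q < (z ^ e).+2)%N%:R * (z ^ e).+2%:R + n%:R / e%:R :> R.
Proof.
move=> /andP[q0 qn] e0; have ne0 : 0 <= n%:R / e%:R :> R by rewrite divr_ge0.
have [zq|qz] := ltnP q (z ^ e).+2.
  apply: (@le_trans _ _ q%:R); last first.
    by rewrite mul1r; apply: ler_wpDr => //; rewrite ler_nat ltnW.
  have [c1 c2] := (count_gt_le R z q0, size_primitives_le R q0).
  have h1 : (count_gt R q z)%:R <= q%:R :> R by rewrite ler_nat.
  have h2 : (size (primitives R q))%:R <= q%:R :> R by rewrite ler_nat.
  have h3 : 0 <= (count_gt R q z)%:R :> R by [].
  have h4 : 0 <= (size (primitives R q))%:R :> R by [].
  by rewrite ler_norml; case: ifP => _; apply/andP; split; lra.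
rewrite mul0r add0r; case: ifPn => mq.
  by rewrite count_gt_multiple ?subrr ?normr0 //; apply: leq_trans qz.
rewrite subr0 ger0_norm // ler_pdivlMr ?ltr0n // -natrM ler_nat.
have /allPn[p] := mq; rewrite mem_primes_upto => /andP[pp pz] npq.
apply: leq_trans qn; apply: leq_trans (totient_leq q).
rewrite -[X in (_ * X <= _)%N](expn1 e);
  apply: (@count_gt_mul_le _ q z e [:: p]) => //=.
- by rewrite pp.
- by move=> r; rewrite inE => /eqP ->; rewrite pz.
- by rewrite muln1 (leq_trans _ qz) // ltnW.
Qed.

(** The constant [c] is [1 / (2 zeta(2) ^ 2)]. Up to a negligible error the characters counted are
    those whose conductor is divisible by every prime up to [z]. *)
Lemma exists_total_gt_cvg (R : realType) : exists2 c : R, 0 < c & forall z : nat,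
  (total_gt R z n)%:R / n%:R ^+ 2 @[n --> \oo] -->
  c * \prod_(p <- primes_upto z) dens R p.
Proof.
have [Z Z0 cZ] := sum_inv_sqr_cvg R.
exists ((2 * Z ^+ 2)^-1); first by rewrite invr_gt0 mulr_gt0 // exprn_gt0.
move=> z; set P := primes_upto z; set L := _ * _.
pose G n : R := \sum_(1 <=
  q < n.+1 | multiple_of_all P q) (size (primitives R q))%:R.
have cG : G n / n%:R ^+ 2 @[n --> \oo] --> L.
  have hs q : (0 < q)%N -> (totient q)%:R =
    \sum_(d <- divisors q) (size (primitives R d))%:R :> R.
    by move=> q0; rewrite (totient_sum_primitives R q0) natr_sum.
  have := @sum_multiple_avoids_cvg R Z _ P [::] cZ Z0 hs.
  rewrite cats0 big_nil mulr1 => /(_ (primes_upto_uniq z)) h.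
  have /h : all prime P by apply/allP => p; rewrite mem_primes_upto => /andP[].
  apply: cvg_trans; apply: near_eq_cvg; exists 0%N => // n _.
  by congr (_ / _); apply: eq_bigl => q; rewrite andbT.
(* Here [e] is fixed first, to make [1 / e] small; then [n] grows and [(z ^ e).+2 ^ 2] becomes
   negligible against [n ^ 2]. *)
have FG e n : (0 < e)%N ->
    `|(total_gt R z n)%:R - G n| <= (z ^ e).+2%:R ^+ 2 + n%:R ^+ 2 / e%:R.
  move=> e0; rewrite /total_gt natr_sum /G [X in _ - X]big_mkcond -sumrB.
  apply: (le_trans (ler_norm_sum _ _ _)).
  apply: (@le_trans _ _ (\sum_(1 <= q < n.+1)
      ((q < (z ^ e).+2)%N%:R * (z ^ e).+2%:R + n%:R / e%:R))).
    rewrite big_nat [leRHS]big_nat; apply: ler_sum => q qn.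
    exact: count_gt_multiple_approx.
  rewrite big_split /= lerD //.
    by rewrite -mulr_suml expr2 ler_wpM2r // -natr_sum ler_nat sum_small_le.
  by rewrite big_const_nat iter_addr_0 subn1 /= -[leLHS]mulr_natr mulrAC -expr2.
apply/cvgn_leP => eps eps0.
have e3 : 0 < eps / 3 by rewrite divr_gt0.
have [N HN] := (cvgn_leP _ _).1 cG _ e3.
pose e := (Num.truncn ((eps / 3)^-1)).+1.
have eE : e%:R^-1 <= eps / 3 :> R.
  rewrite -[leRHS]invrK lef_pV2 ?posrE ?invr_gt0 ?ltr0n //.
  by apply: ltW; exact: truncnS_gt.
have [N' HN'] := (cvgn_leP _ _).1 (cvg_invn_mul ((z ^ e).+2%:R ^+ 2 : R)) _ e3.
exists (maxn 1 (maxn N N')) => n; rewrite !geq_max => /and3P[n1 Nn N'n].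
have n0 : 0 < n%:R ^+ 2 :> R by rewrite exprn_gt0 // ltr0n.
have h1 := HN _ Nn; have := HN' _ N'n; rewrite subr0 => h2.
have h3 : `|((total_gt R z n)%:R - G n) / n%:R ^+ 2| <= eps / 3 + eps / 3.
  rewrite normf_div [X in _ / X]gtr0_norm // ler_pdivrMr //.
  apply: (le_trans (FG e n isT)); rewrite mulrDl lerD //; last first.
    by rewrite mulrC ler_wpM2r // ltW.
  move: h2; rewrite ger0_norm ?divr_ge0 ?exprn_ge0 // ler_pdivrMr ?ltr0n // => h2.
  apply: (le_trans h2); rewrite expr2 mulrA ler_peMr ?ler1n //.
  by rewrite mulr_ge0 // ltW.
have -> : (total_gt R z n)%:R / n%:R ^+ 2 - L =
  ((total_gt R z n)%:R - G n) / n%:R ^+ 2 + (G n / n%:R ^+ 2 - L) by rewrite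
    mulrBl; ring.
apply: (le_trans (ler_normD _ _)); apply: (le_trans (lerD h3 h1)); lra.
Qed.

(** * Bounds uniform in [z] *)

Lemma leq_count_gt (R : realType) (q z z' : nat) : (z <= z')%N ->
  (count_gt R q z' <= count_gt R q z)%N.
Proof. by move=> zz; apply: sub_count => chi /=; exact: leq_ltn_trans. Qed.

Lemma leq_total_gt (R : realType) (z z' n : nat) : (z <= z')%N ->
  (total_gt R z' n <= total_gt R z n)%N.
Proof. by move=> zz; apply: leq_sum => q _; exact: leq_count_gt. Qed.

Lemma total_gt_large_sieve (R : realType) (n z j k : nat) :
  (forall q, (0 < q <= n)%N -> exists s, [/\ size s = k, uniq s, all prime s &
     {in s, forall p, (p <= z)%N && ~~ (p %| q)%N}]) ->
  ((total_gt R z n * 'C(k, j)) ^ 2 <=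
    (z ^ j).+1 * (total_gt R z n * (z ^ j).+1 + total_gt R z n ^ 2 * n ^ 2))%N.
Proof.
move=> hs; set r := total_gt R z n.
pose X := [seq (q, chi) | q <- index_iota 1 n.+1,
  chi <- [seq chi <- nonprincipal_primitives R q | (z < least_nonresidue chi)%N]].
have sX : size X = r.
  rewrite size_allpairs_dep sumnE big_map /r /total_gt; apply: eq_bigr => q _.
  by rewrite size_filter.
rewrite -sX; apply: large_sieve_trivial.
  apply: allpairs_uniq_dep => [|q _|[q chi] [q' chi'] _ _ /= [-> ->] //].
    exact: iota_uniq.
  exact/filter_uniq/fset_uniq.
move=> _ /allpairsPdep[q [chi [qn + ->]]] /=.
rewrite mem_index_iota in qn; have /andP[q0 _] := qn.
rewrite mem_filter => /andP[zl /(nonprincipal_primitivesP _ q0)[pc nc]];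
  split => //.
  exact/(least_nonresidueP q0 pc.1 nc).2.
exact: hs.
Qed.

(* The large sieve inequality solved for the number [r] of characters: with
   [M = t ^ (18 j)] and [N = t ^ (20 j) + 1], the off-diagonal term is absorbed
   by the left-hand side as soon as [2 n <= t ^ (8 j)]. *)
Lemma large_sieve_solve (r n t j M : nat) :
  (0 < t)%N -> (0 < n)%N -> (t ^ (18 * j) <= M)%N -> (2 * n <= t ^ (8 * j))%N ->
  ((r * M) ^ 2 <= ((t ^ 20) ^ j).+1 * (r * ((t ^ 20) ^ j).+1 + r ^ 2 * n ^ 2))%N ->
  (r <= 8 * t ^ (4 * j))%N.
Proof.
move=> t0 n0 hM hn; have [->//|r0] := posnP r.
(* All sizes become powers of [u]: [t ^ (20 j) = u ^ 5], [t ^ (8 j) = u ^ 2] and [M ^ 2 >= u ^ 9];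
   the conclusion amounts to [r * u ^ 9 <= 8 * u ^ 10]. *)
set u := (t ^ (4 * j))%N; have u0 : (0 < u)%N by rewrite expn_gt0 t0.
have E20 : ((t ^ 20) ^ j = u ^ 5)%N by rewrite -!expnM; congr (_ ^ _)%N; lia.
have E8 : (t ^ (8 * j) = u ^ 2)%N by rewrite -!expnM; congr (_ ^ _)%N; lia.
have E36 : (u ^ 9 <= M ^ 2)%N.
  apply: (@leq_trans ((t ^ (18 * j)) ^ 2)); last by apply: leq_exp2r_mono.
  by rewrite -!expnM leq_eqVlt; apply/orP; left; apply/eqP; congr (_ ^ _)%N; lia.
rewrite E20; rewrite E8 in hn => H.
have H1 : (r * M ^ 2 <= (u ^ 5).+1 ^ 2 + (u ^ 5).+1 * (r * n ^ 2))%N.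
  rewrite -(@leq_pmul2l r) //; apply: leq_trans (leq_trans _ H) _.
    by rewrite expnMn -mulnn mulnA.
  rewrite -!mulnn; move: (u ^ 5)%N (n * n)%N => x y; nia.
have U5 : (0 < u ^ 5)%N by rewrite expn_gt0 u0.
have h4 : (4 * n ^ 2 <= u ^ 4)%N.
  rewrite (_ : 4 = 2 ^ 2)%N // -expnMn -[(u ^ 4)%N]/(u ^ (2 * 2))%N expnM.
  exact: leq_exp2r_mono.
have h5 : (u ^ 9 = u ^ 5 * u ^ 4)%N by rewrite -expnD.
have h6 : (u ^ 10 = u ^ 9 * u)%N by rewrite -expnSr.
have h7 : (u ^ 10 = u ^ 5 * u ^ 5)%N by rewrite -expnD.
have h8 : (2 * ((u ^ 5).+1 * (r * n ^ 2)) <= r * u ^ 9)%N.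
  rewrite h5; apply: (@leq_trans (u ^ 5 * r * (4 * n ^ 2))); last first.
    by rewrite [leqRHS]mulnA [(r * u ^ 5)%N]mulnC leq_mul2l h4 orbT.
  move: (n ^ 2)%N (u ^ 5)%N U5 => y x x0; nia.
have h9 : ((u ^ 5).+1 ^ 2 <= 4 * u ^ 10)%N.
  rewrite h7 -mulnn; move: (u ^ 5)%N U5 => x x0; nia.
have h10 : (r * u ^ 9 <= r * M ^ 2)%N by rewrite leq_mul2l E36 orbT.
have : (r * u ^ 9 <= 8 * u * u ^ 9)%N.
  move: h6 h8 h9 h10 H1 => ->.
  move: (u ^ 9)%N (r * M ^ 2)%N ((u ^ 5).+1 ^ 2)%N ((u ^ 5).+1 * (r * n ^ 2))%N =>
    a b c d.
  lia.
by rewrite leq_pmul2r // expn_gt0 u0.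
Qed.

(** The large sieve with [z = t ^ 20] and [k = 400 * t ^ 19] primes leaves at most [8 * t ^ (4 j)]
    characters, which is of order at most [sqrt n * t ^ 4]. As [t ^ 10 <= n], this is at most
    [12 * n / t]. *)
Lemma total_gt_large_range (R : realType) : exists t0, forall n, (0 < n)%N ->
  (t0 <= cutoff n)%N -> (total_gt R (cutoff n ^ 20) n * cutoff n <= 12 * n)%N.
Proof.
have [t0 ht0] := many_coprime_primes.
exists (maxn t0 2) => n n0; set t := cutoff n; rewrite geq_max => /andP[tt0 t2].
have tn : (t ^ (840 * t) <= n)%N by exact: cutoff_le.
have nt : (n < t.+1 ^ (840 * t.+1))%N by exact: cutoff_lt.
move: (t) tt0 t2 tn nt => {}t tt0 t2 tn nt.
have tpos : (0 < t)%N by apply: ltnW.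
(* Minimality of [j] keeps [t ^ (8 j)] below [2 n * t ^ 8], and gives [j <= 400 t], hence
   ['C(k, j) >= (k / j) ^ j >= t ^ (18 j)]. *)
have [j hj minj] : exists2 j, (2 * n <= t ^ (8 * j))%N &
    forall i, (2 * n <= t ^ (8 * i))%N -> (j <= i)%N.
  have ex : exists i, (2 * n <= t ^ (8 * i))%N.
    exists (2 * n)%N; apply: (@leq_trans (t ^ (2 * n))%N);
      last by rewrite leq_pexp2l // leq_pmull.
    by rewrite ltnW // ltn_expl.
  by exists (ex_minn ex); case: ex_minnP.
have j0 : (0 < j)%N by case: (j) hj => //; rewrite muln0 expn0; lia.
have hj1 : (t ^ (8 * j.-1) < 2 * n)%N.
  by rewrite ltnNge; apply/negP => /minj; lia.
have j400 : (j <= 400 * t)%N.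
  have h : (t ^ (8 * j.-1) < t ^ ((1680 * t.+1).+1))%N.
    apply: (leq_trans hj1); rewrite expnS leq_mul // ltnW // (leq_trans nt) //.
    rewrite (_ : 1680 * t.+1 = 2 * (840 * t.+1))%N; last by lia.
    by rewrite [leqRHS]expnM; apply: leq_exp2r_mono; rewrite -mulnn; nia.
  by move: h; rewrite ltn_exp2l //; lia.
have hs q : (0 < q <= n)%N -> exists s, [/\ size s =
  (400 * t ^ 19)%N, uniq s, all prime s &
     {in s, forall p, (p <= t ^ 20)%N && ~~ (p %| q)%N}].
  by move=> qn; exact: ht0 tt0 _ _ nt qn.
have := @total_gt_large_sieve R n (t ^ 20) j (400 * t ^ 19) hs;
  set r := total_gt _ _ _ => sieve.
have hM : (t ^ (18 * j) <= 'C(400 * t ^ 19, j))%N.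
  rewrite expnM; apply: leq_bin_exp; rewrite [(t ^ 19)%N]expnS mulnA leq_mul2r.
  by rewrite j400 orbT.
have r8 := large_sieve_solve tpos n0 hM hj sieve.
have r2 : (r ^ 2 <= 64 * (2 * n * t ^ 8))%N.
  have e : ((t ^ (4 * j)) ^ 2 = t ^ (8 * j.-1) * t ^ 8)%N.
    by rewrite -expnM -expnD; congr (_ ^ _)%N; clear -j0; lia.
  have h := leq_mul (ltnW hj1) (leqnn (t ^ 8)%N); rewrite -e in h.
  apply: leq_trans (leq_exp2r_mono 2 r8) _; rewrite expnMn.
  exact: leq_mul (leqnn _) h.
have t10 : (t ^ 10 <= n)%N.
  have h10 : (10 <= 840 * t)%N by clear -t2; lia.
  exact: leq_trans (leq_pexp2l tpos h10) tn.
rewrite -(@leq_exp2r _ _ 2) // !expnMn.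
apply: (@leq_trans (64 * (2 * n * t ^ 8) * t ^ 2))%N;
  first by rewrite leq_mul2r r2 orbT.
have -> : (64 * (2 * n * t ^ 8) * t ^ 2 = 128 * n * t ^ 10)%N.
  by rewrite (_ : 10 = 8 + 2)%N // expnD; move: (t ^ 8)%N (t ^ 2)%N => a b; clear;
    lia.
rewrite (_ : 12 ^ 2 = 144)%N // -mulnn; move: (t ^ 10)%N t10 => a ha; clear -ha;
  nia.
Qed.

(** With [t = cutoff n], the sum is split at [z = t ^ 20]. Below, [total_gt_small_range] with 24
    primes and [e = t], [k = 21] is summed over at most [t ^ 20] values; its first two terms give at
    most [n ^ 2 / t] each. Above, monotonicity in [z] and [total_gt_large_range] give [12 n / t] for
    each of at most [n] values. *)
Lemma sum_total_gt_tail (R : realType) : exists C : R, exists t0 Z0 : nat, 0 <= C /\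
  forall n Z, (0 < n)%N -> (t0 <= cutoff n)%N -> (Z0 <= Z)%N ->
  \sum_(Z.+1 <= z < n) (total_gt R z n)%:R <=
    n%:R ^+ 2 * (C / Z%:R + 14 / (cutoff n)%:R) :> R.
Proof.
have [t0 ht0] := total_gt_large_range R.
have [z0 hz0] := many_large_primes 24.
exists ('C(24, 4)%:R), (maxn t0 2), (maxn z0 1); split => // n Z n0.
set t := cutoff n; rewrite !geq_max => /andP[tt0 t2] /andP[zZ Z1].
have large_range : (total_gt R (t ^ 20) n * t <= 12 * n)%N by exact: ht0.
have tn : (t ^ (840 * t) <= n)%N by exact: cutoff_le.
move: (t) t2 tn large_range {tt0 ht0} => {}t t2 tn large_range.
have tpos : (0 < t)%N by apply: ltnW.
have t0R : 0 < t%:R :> R by rewrite ltr0n.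
have n0R : 0 < n%:R :> R by rewrite ltr0n.
have h21 : (21 <= 840 * t)%N by clear -t2; lia.
have t21 : (t ^ 21 <= n)%N by exact: leq_trans (leq_pexp2l tpos h21) tn.
set C := 'C(24, 4).
have small_range z : (Z < z)%N -> (z <= t ^ 20)%N ->
    (total_gt R z n)%:R <= n%:R + n%:R ^+ 2 / t%:R ^+ 21 + C%:R * n%:R ^+ 2 / z%:R
      ^+ 2 :> R.
  move=> Zz zt; have [S [sS uS hS]] := hz0 z (leq_trans zZ (ltnW Zz)).
  have hq : (z ^ (t * 21) <= (t ^ 20) ^ (t * 21))%N by exact: leq_exp2r_mono.
  have := @total_gt_small_range R S z n t 21 ((t ^ 20) ^ (t * 21))%N uS hS sS isT
    tpos (leq_ltn_trans (leq0n _) Zz) hq.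
  rewrite sS => h; apply: (le_trans h); rewrite -/C !lerD2r -natrX ler_nat.
  (* The exponent of [cutoff] is made for this: the square of [(t ^ 20) ^ (21 t)] is
     [t ^ (840 t)]. *)
  apply: leq_trans tn; rewrite -!expnM.
  by apply: (leq_pexp2l tpos); clear; lia.
have bound z : (Z < z)%N -> (total_gt R z n)%:R <=
   (z < t ^ 20)%N%:R * (n%:R + n%:R ^+ 2 / t%:R ^+ 21) + C%:R * n%:R ^+ 2 / z%:R ^+
     2 +
   12 * n%:R / t%:R :> R.
  move=> Zz; have p1 : 0 <= 12 * n%:R / t%:R :> R by rewrite divr_ge0 ?mulr_ge0.
  have p2 : 0 <= C%:R * n%:R ^+ 2 / z%:R ^+ 2 :> R by rewrite divr_ge0 ?mulr_ge0
    ?exprn_ge0.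
  have [zt|tz] := ltnP z (t ^ 20).
    by rewrite mul1r; apply: (le_trans (small_range z Zz (ltnW zt))); rewrite lerDl.
  rewrite mul0r add0r; apply: (@le_trans _ _ (total_gt R (t ^ 20) n)%:R).
    by rewrite ler_nat leq_total_gt.
  apply: (@le_trans _ _ (12 * n%:R / t%:R)); last by rewrite lerDr.
  by rewrite ler_pdivlMr // -!natrM ler_nat.
rewrite big_nat; apply: (@le_trans _ _ (\sum_(Z.+1 <= z < n | (Z.+1 <= z < n)%N)
   ((z < t ^ 20)%N%:R * (n%:R + n%:R ^+ 2 / t%:R ^+ 21) + C%:R * n%:R ^+ 2 / z%:R
     ^+ 2 +
   12 * n%:R / t%:R))).
  by apply: ler_sum => z /andP[Zz _]; exact: bound.
rewrite -big_nat !big_split /=.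
have s1 : \sum_(Z.+1 <=
  z < n) (z < t ^ 20)%N%:R * (n%:R + n%:R ^+ 2 / t%:R ^+ 21) <=
    n%:R ^+ 2 * (2 / t%:R) :> R.
  rewrite -mulr_suml -natr_sum.
  have c1 : (\sum_(Z.+1 <= z < n) (z < t ^ 20) <= t ^ 20)%N.
    case: (n) => [|m]; first by rewrite big_geq.
    apply: leq_trans (sum_small_le (t ^ 20) m).
    have [Zm|mZ] := leqP Z.+1 m.+1; last by rewrite big_geq // ltnW.
    by rewrite [leqRHS](@big_cat_nat _ _ _ Z.+1) //= leq_addl.
  apply: (@le_trans _ _ ((t ^ 20)%:R * (n%:R + n%:R ^+ 2 / t%:R ^+ 21))).
    by rewrite ler_wpM2r ?ler_nat // addr_ge0 // divr_ge0 // exprn_ge0.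
  have e1 : (t ^ 20)%:R * (n%:R ^+ 2 / t%:R ^+ 21) = n%:R ^+ 2 / t%:R :> R.
    by rewrite natrX [t%:R ^+ 21]exprS; field; rewrite gt_eqF.
  have e2 : (t ^ 20)%:R * n%:R <= n%:R ^+ 2 / t%:R :> R.
    rewrite ler_pdivlMr // mulrAC expr2 ler_wpM2r // -natrM ler_nat.
    by rewrite -expnSr.
  rewrite mulrDr e1; move: e2; rewrite mulrCA mulrA [X in _ -> _ <= X]mulrC; lra.
have s2 : \sum_(Z.+1 <= z < n) C%:R * n%:R ^+ 2 / z%:R ^+ 2 <=
  n%:R ^+ 2 * (C%:R / Z%:R) :> R.
  rewrite -mulr_sumr.
  have := ler_wpM2l (_ : 0 <= C%:R * n%:R ^+ 2 :> R) (sum_inv_sqr_tail R n Z1).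
  rewrite mulr_ge0 ?exprn_ge0 // => /(_ isT); lra.
have s3 : \sum_(Z.+1 <= z < n) 12 * n%:R / t%:R <= n%:R ^+ 2 * (12 / t%:R) :> R.
  rewrite big_const_nat iter_addr_0 -[leLHS]mulr_natr.
  apply: (@le_trans _ _ (12 * n%:R / t%:R * n%:R)).
    by rewrite ler_wpM2l ?divr_ge0 ?mulr_ge0 // ler_nat leq_subr.
  by rewrite le_eqVlt; apply/orP; left; apply/eqP; ring.
have := lerD (lerD s1 s2) s3; rewrite -!mulrDr.
have -> : 2 / t%:R + C%:R / Z%:R + 12 / t%:R = C%:R / Z%:R + 14 / t%:R :> R by ring.
by [].
Qed.

Local Close Scope complex_scope.

(** * The average *)

(** This is the product [D z] of the overview. *)
Definition cumdens (R : realType) (z : nat) : R :=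
  \prod_(p <- primes_upto z) dens R p.
Arguments cumdens R z : clear implicits.

Lemma dens_ge0_le1 (R : realType) (p : nat) : prime p -> 0 <= dens R p <= 1.
Proof.
move=> /prime_gt1 p1; rewrite /dens.
have : 2 <= p%:R :> R by rewrite ler_nat.
move: (p%:R) => x x2; have d0 : 0 < (x + 1) ^+ 2 * (x - 1).
  by rewrite mulr_gt0 ?exprn_gt0 //; lra.
rewrite ler_pdivrMr // mul1r divr_ge0 ?(ltW d0) //=; last by nra.
have : 0 <= (x - 1) * (x * (x + 2)) by rewrite !mulr_ge0 //; lra.
nra.
Qed.

Lemma cumdensS (R : realType) (z : nat) :
  cumdens R z.+1 = cumdens R z * (if prime z.+1 then dens R z.+1 else 1).
Proof.
rewrite /cumdens /primes_upto -[in LHS]addn1 iotaD filter_cat big_cat /= add0n.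
by case: ifP => _; rewrite ?big_seq1 ?big_nil.
Qed.

Lemma cumdens0 (R : realType) : cumdens R 0 = 1.
Proof. by rewrite /cumdens big_nil. Qed.

Lemma cumdens_ge0 (R : realType) (z : nat) : 0 <= cumdens R z.
Proof.
rewrite /cumdens big_seq; apply: prodr_ge0 => p; rewrite mem_primes_upto.
by move=> /andP[/(@dens_ge0_le1 R)/andP[]].
Qed.

Lemma cumdens_le (R : realType) (y z : nat) : (y <= z)%N ->
  cumdens R z <= cumdens R y.
Proof.
elim: z => [|z IH]; first by rewrite leqn0 => /eqP ->.
rewrite leq_eqVlt => /orP[/eqP -> //|yz]; apply: le_trans (IH yz).
rewrite cumdensS ler_piMr ?cumdens_ge0 //; case: ifP => // pz.
by have /andP[] := dens_ge0_le1 R pz.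
Qed.

Lemma prod_dens (R : realType) (z : nat) :
  \prod_(0 <= p < z.+1 | prime p)
    ((p%:R ^+ 2 - p%:R - 1) / ((p%:R + 1) ^+ 2 * (p%:R - 1))) = cumdens R z.
Proof. by rewrite /cumdens /primes_upto big_filter. Qed.

(** Summation by parts: [l ^ 4 / ((l + 1) ^ 2 (l - 1)) = l (1 - dens R l)], so the term at a prime
    [l] is [l] times the drop of [cumdens] at [l]. At other integers [cumdens] does not drop. *)
Lemma partial_Delta_star (R : realType) (n : nat) :
  \sum_(0 <= l < n.+1 | prime l) Delta_star_term R l =
  \sum_(0 <= z < n) cumdens R z - n%:R * cumdens R n.
Proof.
elim: n => [|n IH]; first by rewrite big_mkcond big_nat1 /= big_geq // mul0r subr0.
rewrite big_mkcond big_nat_recr //= -big_mkcond IH [in RHS]big_nat_recr //=.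
rewrite cumdensS; case: ifPn => pn; last by rewrite -natr1; ring.
rewrite /Delta_star_term prod_dens /dens.
have : 2 <= n.+1%:R :> R by rewrite ler_nat prime_gt1.
rewrite -[n.+1%:R]natr1; move: (n%:R : R) (cumdens R n) => x y x2.
have h1 : x + 1 + 1 != 0 by rewrite gt_eqF //; lra.
have h2 : x + 1 - 1 != 0 by rewrite gt_eqF //; lra.
by field; rewrite ?h1 ?h2 //= ; apply/andP; split; rewrite gt_eqF //; lra.
Qed.

Lemma cvg_cutoff (R : realType) (c : R) : c / (cutoff n)%:R @[n --> \oo] --> 0.
Proof.
apply/cvgn_leP => e e0; have [N HN] := (cvgn_leP _ _).1 (cvg_invn_mul c) _ e0.
exists (N ^ (840 * N))%N => n Nn; apply: HN; exact: cutoff_ge.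
Qed.

Lemma sum_range_total_gt_cvg (R : realType) (c : R) (Z : nat) :
  (forall z, (total_gt R z n)%:R / n%:R ^+ 2 @[n --> \oo] --> c * cumdens R z) ->
  forall Y, (\sum_(Y <= z < Z) (total_gt R z n)%:R) / n%:R ^+ 2 @[n --> \oo] -->
  c * \sum_(Y <= z < Z) cumdens R z.
Proof.
move=> cF Y.
have nilc m : (m <= Y)%N -> (\sum_(Y <= z < m) (total_gt R z n)%:R) / n%:R ^+ 2
    @[n --> \oo] --> c * \sum_(Y <= z < m) cumdens R z.
  move=> mY; rewrite big_geq // mulr0;
    under eq_fun => n do rewrite big_geq // mul0r.
  exact: cvg_cst.
elim: Z => [|Z IH]; first exact: nilc.
have [YZ|ZY] := leqP Y Z; last exact: nilc.
rewrite big_nat_recr //= mulrDr.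
under eq_fun => n do rewrite big_nat_recr //= mulrDl.
exact: cvgD.
Qed.

(** The partial sums are bounded because, up to the factor [c], they are limits of the normalized
    sums of [total_gt], whose tails [sum_total_gt_tail] controls. *)
Lemma series_cumdens_cvg (R : realType) : exists D : R,
  \sum_(0 <= z < n) cumdens R z @[n --> \oo] --> D.
Proof.
have [c c0 cF] := exists_total_gt_cvg R.
have [C [t0 [Z0 [C0 tail]]]] := sum_total_gt_tail R.
pose S n : R := \sum_(0 <= z < n) cumdens R z.
have Snd : nondecreasing_seq S.
  apply/nondecreasing_seqP => n; rewrite /S [leRHS]big_nat_recr //= lerDl.
  exact: cumdens_ge0.
have bT m : c * \sum_(Z0.+1 <= z < m) cumdens R z <= C / Z0%:R.
  have cu : C / Z0%:R + 14 / (cutoff n)%:R @[n --> \oo] --> C / Z0%:R + 0.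
    by apply: cvgD; [exact: cvg_cst|exact: cvg_cutoff].
  have cA := @sum_range_total_gt_cvg R c m cF Z0.+1.
  rewrite -[leRHS]addr0; apply: (ler_cvg_to cA cu).
  exists (maxn (maxn 1 m) (t0 ^ (840 * t0))) => // n /=.
  rewrite !geq_max => /andP[/andP[n1 mn] tn].
  have n0 : 0 < n%:R ^+ 2 :> R by rewrite exprn_gt0 // ltr0n.
  rewrite ler_pdivrMr // mulrC;
    apply: le_trans (tail n Z0 n1 (cutoff_ge tn) (leqnn _)).
  have [Zm|mZ] := leqP Z0.+1 m; last by rewrite big_geq ?sumr_ge0 // ltnW.
  by rewrite [leRHS](@big_cat_nat _ _ _ m) //= lerDl sumr_ge0.
have ub : has_ubound (range S).
  exists (\sum_(0 <= z < Z0.+1) cumdens R z + C / Z0%:R / c) => _ [m _ <-];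
    rewrite /S.
  have cz : 0 <= C / Z0%:R / c by rewrite divr_ge0 ?divr_ge0 // ltW.
  have [Zm|mZ] := leqP Z0.+1 m.
    rewrite (@big_cat_nat _ _ _ Z0.+1) //= lerD2l ler_pdivlMr // mulrC.
    exact: bT.
  apply: (@le_trans _ _ (\sum_(0 <= z < Z0.+1) cumdens R z)); last by rewrite lerDl.
  rewrite [leRHS](@big_cat_nat _ _ _ m) //=; last exact: ltnW.
  by rewrite lerDl sumr_ge0 // => z _; exact: cumdens_ge0.
by exists (limn S); exact: nondecreasing_is_cvgn Snd ub.
Qed.

Lemma Delta_star_cvg (R : realType) :
  \sum_(0 <= z < n) cumdens R z @[n --> \oo] --> Delta_star R.
Proof.
have [D cD] := series_cumdens_cvg R.
suff -> : Delta_star R = D by [].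
pose S n : R := \sum_(0 <= z < n) cumdens R z.
have cS : S n @[n --> \oo] --> D by exact: cD.
(* The boundary term vanishes because [cumdens] decreases: [n / 2 * cumdens R n] is at most the sum
   over [n %/ 2 <= z < n], a difference of partial sums of a convergent series. *)
have nL : n%:R * cumdens R n @[n --> \oo] --> (0 : R).
  have c2 : 2 * (S n - S (n %/ 2)%N) @[n --> \oo] --> 2 * (D - D).
    by apply: cvgMr; apply: cvgB => //; exact: (@cvg_divn R 2 S).
  rewrite subrr mulr0 in c2; apply: squeeze_cvgr (cvg_cst 0) c2.
  exists 0%N => // n _; rewrite mulr_ge0 ?cumdens_ge0 //=.
  have E : S n - S (n %/ 2)%N = \sum_(n %/ 2 <= z < n) cumdens R z.
    by rewrite /S (@big_cat_nat _ _ _ (n %/ 2)) ?leq_div //= addrAC subrr add0r.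
  have h : \sum_(n %/ 2 <= z < n) cumdens R n <= S n - S (n %/ 2)%N.
    rewrite E big_nat [leRHS]big_nat; apply: ler_sum => z /andP[_ zn].
    exact/cumdens_le/ltnW.
  rewrite big_const_nat iter_addr_0 -[leLHS]mulr_natl in h.
  apply: le_trans (ler_wpM2l (ler0n R 2) h).
  rewrite mulrA ler_wpM2r ?cumdens_ge0 // -natrM ler_nat.
  have := leq_trunc_div n 2; lia.
have cu : \sum_(0 <= l < n.+1 | prime l) Delta_star_term R l @[n --> \oo] --> D - 0.
  under eq_fun => n do rewrite partial_Delta_star.
  exact: cvgB.
rewrite subr0 in cu; rewrite /Delta_star; apply: cvg_lim => //.
by rewrite -cvg_shiftS.
Qed.

(** Cut at a fixed [Z]: the head converges termwise and the tail is bounded uniformly. The four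
    quarters of [e] pay for the head, the remainder of the series, [C / Z] and [14 / cutoff n]. *)
Lemma sum_total_gt_cvg (R : realType) (c : R) :
  0 < c -> (forall z, (total_gt R z n)%:R / n%:R ^+ 2 @[n --> \oo] --> c * cumdens
    R z) ->
  (\sum_(0 <= z < n) (total_gt R z n)%:R) / n%:R ^+ 2 @[n --> \oo] --> c *
    Delta_star R.
Proof.
move=> c0 cF; have [C [t0 [Z0 [C0 tail]]]] := sum_total_gt_tail R.
apply/cvgn_leP => e e0; have e4 : 0 < e / 4 by rewrite divr_gt0.
have e4c : 0 < e / 4 / c by rewrite divr_gt0.
have [N1 HN1] := (cvgn_leP _ _).1 (cvg_invn_mul C) _ e4.
have [N2 HN2] := (cvgn_leP _ _).1 (@Delta_star_cvg R) _ e4c.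
pose Z := maxn Z0 (maxn N1 N2).
have ZZ0 : (Z0 <= Z)%N by rewrite leq_maxl.
have ZN1 : (N1 <= Z)%N by rewrite !leq_max leqnn /= orbT.
have ZN2 : (N2 <= Z.+1)%N by rewrite leqW // !leq_max leqnn !orbT.
have [N3 HN3] := (cvgn_leP _ _).1 (@sum_range_total_gt_cvg R c Z.+1 cF 0%N) _ e4.
have [N4 HN4] := (cvgn_leP _ _).1 (@cvg_cutoff R 14) _ e4.
exists (maxn (maxn Z.+1 (t0 ^ (840 * t0))) (maxn N3 N4)) => n.
rewrite !geq_max => /andP[/andP[Zn tn] /andP[N3n N4n]].
have n0 : (0 < n)%N by apply: leq_trans Zn.
have n20 : 0 < n%:R ^+ 2 :> R by rewrite exprn_gt0 // ltr0n.
rewrite (@big_cat_nat _ _ _ Z.+1) //= mulrDl.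
have h1 := HN1 _ ZN1; have h2 := HN2 _ ZN2; have h3 := HN3 _ N3n;
  have h4 := HN4 _ N4n.
rewrite subr0 in h1; rewrite subr0 in h4.
have h5 : (\sum_(Z.+1 <= z < n) (total_gt R z n)%:R) / n%:R ^+ 2 <= e / 4 + e / 4.
  rewrite ler_pdivrMr // mulrC; apply: (le_trans (tail n Z n0 (cutoff_ge tn) ZZ0)).
  rewrite ler_wpM2l ?(ltW n20) // lerD //.
    exact: le_trans (ler_norm _) h1.
  exact: le_trans (ler_norm _) h4.
have h50 : 0 <= (\sum_(Z.+1 <= z < n) (total_gt R z n)%:R) / n%:R ^+ 2 :> R.
  by rewrite divr_ge0 ?sumr_ge0 // ltW.
have h6 : `|c * (\sum_(0 <= z < Z.+1) cumdens R z) - c * Delta_star R| <= e / 4.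
  by rewrite -mulrBr normrM gtr0_norm // mulrC -ler_pdivlMr.
move: h3 h6 h5 h50; rewrite !ler_norml.
set s := (\sum_(0 <= z < Z.+1) (total_gt R z n)%:R) / _;
  set u := (\sum_(_ <= _ < n) _) / _.
set v := c * _; set w := c * _.
by move=> /andP[a1 a2] /andP[b1 b2] g1 g2; apply/andP; split; lra.
Qed.

Theorem theorem3p6 (R : realType) :
  ((\sum_(1 <= q < (Num.truncn x).+1)
      \sum_(chi \in primitive_characters R q) (1 : R))^-1 *
   (\sum_(1 <= q < (Num.truncn x).+1)
      \sum_(chi \in primitive_characters R q) ((least_nonresidue chi)%:R : R)))
  @[x --> (+oo : set_system R)] --> Delta_star R.
Proof.
have [c c0 cF] := exists_total_gt_cvg R.
have cnum := sum_total_gt_cvg c0 cF.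
(* The ratio at integers [n]; dividing both sums by [n ^ 2], the denominator tends to [c], since
   [cumdens R 0 = 1], and the numerator to [c * Delta_star R]. *)
pose g n : R := (total_gt R 0 n)%:R^-1 * \sum_(0 <= z < n) (total_gt R z n)%:R.
have cg : g n @[n --> \oo] --> Delta_star R.
  have c00 := cF 0%N; rewrite -/(cumdens R 0) cumdens0 mulr1 in c00.
  have cn0 : c != 0 by rewrite gt_eqF.
  have c1 : ((total_gt R 0 n)%:R / n%:R ^+ 2)^-1 *
      ((\sum_(0 <= z < n) (total_gt R z n)%:R) / n%:R ^+ 2) @[n --> \oo] -->
      c^-1 * (c * Delta_star R).
    by apply: cvgM => //; apply: cvgV.
  rewrite mulKf // in c1; apply: cvg_trans c1; apply: near_eq_cvg;
    exists 1%N => // n /= n1.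
  have n0 : n%:R ^+ 2 != 0 :> R by rewrite sqrf_eq0 pnatr_eq0 -lt0n.
  rewrite /g invf_div; move: (n%:R ^+ 2) (_^-1) (\sum_(_ <= _ < _) _) n0 =>
    a b d a0.
  by field.
apply/cvgrPdist_le => e e0; have [N HN] := (cvgn_leP _ _).1 cg _ e0.
exists N%:R; split; first exact: num_real.
move=> x Nx; set n := Num.truncn x.
have Nn : (N <= n)%N.
  rewrite leqNgt; apply/negP => nN.
  have : x < N%:R by apply: (lt_le_trans (truncnS_gt x)); rewrite ler_nat.
  by rewrite ltNge (ltW Nx).
rewrite distrC; have := HN _ Nn; rewrite /g /total_gt.
have -> : \sum_(1 <= q < n.+1) \sum_(chi \in primitive_characters R q) (1 : R) =
    (\sum_(1 <= q < n.+1) count_gt R q 0)%:R.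
  rewrite natr_sum [LHS]big_nat [RHS]big_nat; apply: eq_bigr => q /andP[q0 _].
  exact: count_primitive.
have -> // : \sum_(1 <= q < n.+1)
     \sum_(chi \in primitive_characters R q) ((least_nonresidue chi)%:R : R) =
   \sum_(0 <= z < n) (\sum_(1 <= q < n.+1) count_gt R q z)%:R.
under [RHS]eq_bigr => z _ do rewrite natr_sum.
rewrite exchange_big /= [LHS]big_nat [RHS]big_nat; apply: eq_bigr => q qn.
exact: (@sum_least_nonresidue R q n qn).
Qed.
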